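(* Let $\{y^j\}$ be the sequence generated by the semismooth Newton method described in the context. Then $\{y^j\}$ is well-defined and converges to the unique solution $\bar y$ of $\min_{y\in\mathbb{R}^m}\psi(y)$. Moreover, the convergence rate is at least superlinear: $$\|y^{j+1}-\bar y\|=O(\|y^j-\bar y\|^{1+\tau}),$$ where $\tau\in(0,1]$ is the parameter given in the method.
   Context: Setting. $\mathcal{A}:\mathbb{R}^n\to\mathbb{R}^m$ is linear with adjoint $\mathcal{A}^*$, $b\in\mathbb{R}^m$, $\lambda_1\ge0$, $\lambda_2\ge0$ with $\lambda_1+\lambda_2>0$. The index sets $G_1,\dots,G_g$ form a partition of $\{1,\dots,n\}$, $w_l>0$, $\lambda_{2,l}:=\lambda_2w_l$, and $x_{G_l}$ is the restriction of $x$ to $G_l$; $\|\cdot\|$ is the Euclidean norm. Put $\varphi(x):=\lambda_1\|x\|_1$ and $p(x):=\varphi(x)+\sum_{l=1}^g\lambda_{2,l}\|x_{G_l}\|$; $p^*$ is the convex conjugate of $p$. For a closed proper convex $q$, $\mathrm{Prox}_q(u):=\arg\min_x\{q(x)+\frac12\|x-u\|^2\}$. Objective. For given $\sigma>0$ and fixed $\tilde x\in\mathbb{R}^n$, $$\psi(y):=\langle b,y\rangle+\tfrac12\|y\|^2+p^*\big(\mathrm{Prox}_{p^*/\sigma}(\sigma^{-1}\tilde x-\mathcal{A}^*y)\big)+\tfrac{\sigma}{2}\|\mathrm{Prox}_p(\sigma^{-1}\tilde x-\mathcal{A}^*y)\|^2,\quad y\in\mathbb{R}^m,$$ which is strongly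 convex and continuously differentiable with $\nabla\psi(y)=b+y-\sigma\mathcal{A}\,\mathrm{Prox}_p(\sigma^{-1}\tilde x-\mathcal{A}^*y)$. Multifunction $\mathcal{M}$. $\mathcal{P}_lx:=x_{G_l}$, $\mathcal{P}:=[\mathcal{P}_1;\dots;\mathcal{P}_g]$ with adjoint $\mathcal{P}^*$; $\mathcal{B}_2^{\lambda_{2,l}}:=\{u_l\in\mathbb{R}^{|G_l|}:\|u_l\|\le\lambda_{2,l}\}$ with Euclidean projection $\Pi_{\mathcal{B}_2^{\lambda_{2,l}}}$; $\partial F$ denotes the Clarke generalized Jacobian of a locally Lipschitz map $F$. For $u\in\mathbb{R}^n$, $$\mathcal{M}(u):=\left\{(I-\mathcal{P}^*\Sigma\mathcal{P})\Theta\ \middle|\ \Sigma=\mathrm{Diag}(\Sigma_1,\dots,\Sigma_g)\text{ (block diagonal)},\ \Sigma_l\in\partial\Pi_{\mathcal{B}_2^{\lambda_{2,l}}}(v_{G_l}),\ l=1,\dots,g,\ v=\mathrm{Prox}_\varphi(u),\ \Theta\in\partial\mathrm{Prox}_\varphi(u)\right\}.$$ Semismooth Newton method. Given $\mu\in(0,1/2)$, $\bar\eta\in(0,1)$, $\tau\in(0,1]$, $\delta\in(0,1)$ and $y^0\in\mathbb{R}^m$, iterate for $j=0,1,\dots$: Step 1. Choose $M_j\in\mathcal{M}(\sigma^{-1}\tilde x-\mathcal{A}^*y^j)$ and let $V_j=I+\sigma\mathcal{A}M_j\mathcal{A}^*$. Solve the linear system $V_jd=-\nabla\psi(y^j)$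 exactly or by the conjugate gradient algorithm to find $d^j$ such that $\|V_jd^j+\nabla\psi(y^j)\|\le\min(\bar\eta,\|\nabla\psi(y^j)\|^{1+\tau})$. Step 2. (Line search) Set $\alpha_j=\delta^{m_j}$, where $m_j$ is the smallest nonnegative integer $m$ for which $\psi(y^j+\delta^md^j)\le\psi(y^j)+\mu\delta^m\langle\nabla\psi(y^j),d^j\rangle$. Step 3. Set $y^{j+1}=y^j+\alpha_jd^j$. *)

(* Defs.v *)
From HB Require Import structures.
From mathcomp Require Export all_boot all_order all_algebra.
From mathcomp Require Export all_classical all_reals all_analysis.
Export Order.TTheory GRing.Theory Num.Theory numFieldNormedType.Exports.

Set Implicit Arguments.
Unset Strict Implicit.
Unset Printing Implicit Defensive.

Global Open Scope classical_set_scope.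
Global Open Scope ring_scope.

(* The norm that the library puts on matrices is the sup norm; it induces the
   Euclidean topology, so [differentiable], [-->] and so on are used as they
   are, but the Euclidean norm itself has to be defined. *)
Section Euclidean.
Context {R : realType} {n : nat}.
Implicit Types (u v x : 'cV[R]_n) (C : set 'cV[R]_n).

Definition dotp u v : R := \sum_i u i 0 * v i 0.
Definition enorm u : R := Num.sqrt (dotp u u).
Definition l1norm u : R := \sum_i `|u i 0|.

(* arbitrary value if no nearest point exists *)
Definition proj C u : 'cV[R]_n :=
  get [set x | C x /\ forall z, C z -> enorm (x - u) <= enorm (z - u)].

Definition eball (r : R) : set 'cV[R]_n := [set x | enorm x <= r].

Definition grad (f : 'cV[R]_n -> R) x : 'cV[R]_n :=
  \col_i 'D_(delta_mx i 0) (f : 'cV[R]_n -> R^o) x.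

Definition conjugate (q : 'cV[R]_n -> \bar R) (z : 'cV[R]_n) : \bar R :=
  ereal_sup [set ((dotp z x)%:E - q x)%E | x in setT].

(* [get] picks the minimizer, which exists and is unique when [q] is closed,
   proper and convex. *)
Definition prox (q : 'cV[R]_n -> \bar R) u : 'cV[R]_n :=
  get [set x | forall z, (q x + (2^-1 * enorm (x - u) ^+ 2)%:E <=
                          q z + (2^-1 * enorm (z - u) ^+ 2)%:E)%E].

Definition is_minimizer (f : 'cV[R]_n -> R) x := forall z, f x <= f z.

End Euclidean.

Section ClarkeJacobian.
Context {R : realType}.

Definition convex_hull (E : lmodType R) (S : set E) : set E :=
  [set x | forall C : set E, convex_set C -> S `<=` C -> C x].

(* The library's [jacobian] acts on row vectors; this is its counterpart for
   column vectors, i.e. 'd F x h = Jac F x *m h. *)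
Definition Jac n m (F : 'cV[R]_n -> 'cV[R]_m) (x : 'cV[R]_n) : 'M[R]_(m, n) :=
  \matrix_(i, j) ('d F x (delta_mx j 0)) i 0.

Definition limiting_Jac n m (F : 'cV[R]_n -> 'cV[R]_m) (x : 'cV[R]_n) :
    set 'M[R]_(m, n) :=
  [set J | exists u : nat -> 'cV[R]_n,
     [/\ forall k, differentiable F (u k), u @ \oo --> x &
         (fun k => Jac F (u k)) @ \oo --> J]].

Definition clarke_Jac n m (F : 'cV[R]_n -> 'cV[R]_m) (x : 'cV[R]_n) :
    set 'M[R]_(m, n) :=
  convex_hull (limiting_Jac F x).

End ClarkeJacobian.

Section SparseGroupLasso.
Context {R : realType} {n m g : nat}.
Variables (A : 'M[R]_(m, n)) (b : 'cV[R]_m) (lambda1 lambda2 : R).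
Variables (G : 'I_g -> {set 'I_n}) (w : 'I_g -> R).
Variables (sigma : R) (xtilde : 'cV[R]_n).

(* matrix of x |-> x_{G_l} *)
Definition restr_mx (l : 'I_g) : 'M[R]_(#|G l|, n) :=
  \matrix_(i, j) (enum_val i == j)%:R.

Definition group_mx : 'M[R]_(\sum_(l < g) #|G l|, n) :=
  \mxcol_(l < g) restr_mx l.

Definition lambda2l (l : 'I_g) : R := lambda2 * w l.

Definition phi (x : 'cV[R]_n) : R := lambda1 * l1norm x.

Definition sgl_reg (x : 'cV[R]_n) : R :=
  phi x + \sum_(l < g) lambda2l l * enorm (restr_mx l *m x).

Definition prox_phi : 'cV[R]_n -> 'cV[R]_n := prox (EFin \o phi).

Definition sgl_reg_conj : 'cV[R]_n -> \bar R := conjugate (EFin \o sgl_reg).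

(* [fine] is harmless: a value of the prox of p^* / sigma lies in the effective
   domain of p^*, which is proper. *)
Definition psi (y : 'cV[R]_m) : R :=
  let u := sigma^-1 *: xtilde - A^T *m y in
  dotp b y + 2^-1 * enorm y ^+ 2
  + fine (sgl_reg_conj
            (prox (fun z => ((sigma^-1)%:E * sgl_reg_conj z)%E) u))
  + sigma / 2 * enorm (prox (EFin \o sgl_reg) u) ^+ 2.

Definition Mset (u : 'cV[R]_n) : set 'M[R]_n :=
  [set M | exists (S : forall l : 'I_g, 'M[R]_#|G l|) (Theta : 'M[R]_n),
     [/\ forall l, clarke_Jac (proj (eball (lambda2l l)))
                              (restr_mx l *m prox_phi u) (S l),
         clarke_Jac prox_phi u Theta &
         M = (1%:M - group_mx^T *m (\mxdiag_(l < g) S l) *m group_mx)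
             *m Theta]].

Definition newton_mx (y : 'cV[R]_m) : set 'M[R]_m :=
  [set V | exists2 M, Mset (sigma^-1 *: xtilde - A^T *m y) M &
                      V = 1%:M + sigma *: (A *m M *m A^T)].

End SparseGroupLasso.

(* Conjugate gradient algorithm for V x = c, started at 0; the state is
   (iterate, residual, search direction).  Once the residual vanishes the
   quotients are 0 / 0 = 0 and the iterate no longer changes. *)
Section ConjugateGradient.
Context {R : realType} {m : nat}.
Variables (V : 'M[R]_m) (c : 'cV[R]_m).

Definition cg_step (s : 'cV[R]_m * 'cV[R]_m * 'cV[R]_m) :=
  let: (x, r, q) := s in
  let a := dotp r r / dotp q (V *m q) in
  let r' := r - a *: (V *m q) in
  (x + a *: q, r', r' + (dotp r' r' / dotp r r) *: q).

Definition cg_iterate (k : nat) : 'cV[R]_m := (iter k cg_step (0, c, c)).1.1.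

End ConjugateGradient.

(* The method for a function f, the matrices V_j being taken in [Vs y_j]. *)
Section SemismoothNewton.
Context {R : realType} {m : nat}.
Variables (f : 'cV[R]_m -> R) (Vs : 'cV[R]_m -> set 'M[R]_m).
Variables (mu eta tau delta : R).
Implicit Types (y d : 'cV[R]_m) (V : 'M[R]_m).

Definition newton_accurate y V d :=
  enorm (V *m d + grad f y) <= Num.min eta (enorm (grad f y) `^ (1 + tau)).

Definition newton_direction y V d :=
  (V *m d = - grad f y \/ exists k, d = cg_iterate V (- grad f y) k) /\
  newton_accurate y V d.

Definition armijo y d (k : nat) :=
  f (y + delta ^+ k *: d) <= f y + mu * delta ^+ k * dotp (grad f y) d.

Definition armijo_index y d (k : nat) :=
  armijo y d k /\ forall i, (i < k)%N -> ~ armijo y d i.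

Definition ssn_step y y' :=
  exists V d k, [/\ Vs y V, newton_direction y V d, armijo_index y d k &
                    y' = y + delta ^+ k *: d].

Definition ssn_sequence y0 (y : nat -> 'cV[R]_m) :=
  y 0%N = y0 /\ forall j, ssn_step (y j) (y j.+1).

(* No choice made in Steps 1 and 2 can block the method, whatever the current
   point y (any y may be the starting point): there is a matrix V; whichever V
   is chosen, an exact solution exists and conjugate gradient reaches the
   required accuracy; whichever admissible d is returned, the line search
   terminates. *)
Definition ssn_well_defined :=
  forall y,
    [/\ Vs y !=set0,
        forall V, Vs y V ->
          (exists d, V *m d = - grad f y) /\
          (exists k, newton_accurate y V (cg_iterate V (- grad f y) k)) &
        forall V d, Vs y V -> newton_direction y V d ->
          exists k, armijo_index y d k].

End SemismoothNewton.

(* Main.v *)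
Require Import Defs.
From mathcomp Require Import ring lra.

Set Implicit Arguments.
Unset Strict Implicit.
Unset Printing Implicit Defensive.

(** The regularizer p is a sum of norms, hence sublinear: its conjugate only
    takes the values 0 and infinity ([fine_conjugate_homogeneous]), and its
    proximal mapping F is explicit, namely soft-thresholding of the entries
    followed in each group by the subtraction of the projection onto a ball
    ([sgl_prox]).  The objective is therefore
      f y = <b, y> + |y|^2 / 2 + sigma / 2 |F u|^2  with  u = x0 - A^T y.
    As u - F u is the projection of u onto a convex set, |F u|^2 / 2 is half a
    squared distance: it is convex, with gradient F, and F is nonexpansive.
    Hence f is strongly convex with a Lipschitz gradient g.

    Every matrix V of the method is symmetric with 1 <= V <= L as a quadratic
    form ([newton_mx_sym], [newton_mx_ge], [newton_mx_le]).  The conjugate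
    gradient algorithm lowers the energy <Vx, x> / 2 - <c, x> at each step, by an
    amount controlled by the residual, so it reaches any accuracy ([cg_reaches]),
    and the iterates, like exact solutions, satisfy <g, d> <= - <Vd, d> / 2.
    Step sizes are then bounded below, the accuracy criterion prevents d from
    being small compared with g, and the gap f y - min f decreases geometrically
    ([ssn_step_gap]).

    The rate comes from two estimates at the minimizer ([newton_local]).  With
    e = y - ybar, they are |g y - V e| = O(|e|^2), the strong semismoothness of g,
    and f y - f ybar - <g y, e> / 2 = O(|e|^3).  The first one and the accuracy of
    d give |e + d| = O(|e|^(1 + tau)); the second one shows that the unit step
    passes the line search near ybar, because mu < 1/2 ([unit_step_accepted]).

    Both estimates reduce to the two building blocks of F.  Soft-thresholding is
    piecewise affine, so that its generalized slopes reproduce its increments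
    exactly near a given point ([soft_near]).  The projection onto a ball is the
    identity inside and smooth outside, with a second-order expansion whose error
    is uniform ([ballp_expansion]); on the sphere its Clarke Jacobian is the
    segment joining the two derivatives ([clarke_ballp]), and the estimates hold
    at both ends of the segment. *)

(** * Euclidean geometry *)

Section Euclid.
Context {R : realType} {n : nat}.
Implicit Types u v x : 'cV[R]_n.

Lemma dotpC u v : dotp u v = dotp v u.
Proof. by apply: eq_bigr => i _; rewrite mulrC. Qed.

Lemma dotpDl u v x : dotp (u + v) x = dotp u x + dotp v x.
Proof. by rewrite -big_split; apply: eq_bigr => i _; rewrite mxE mulrDl. Qed.

Lemma dotpZl a u x : dotp (a *: u) x = a * dotp u x.
Proof. by rewrite mulr_sumr; apply: eq_bigr => i _; rewrite mxE mulrA. Qed.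

Lemma dotpNl u x : dotp (- u) x = - dotp u x.
Proof. by rewrite -scaleN1r dotpZl mulN1r. Qed.

Lemma dotpBl u v x : dotp (u - v) x = dotp u x - dotp v x.
Proof. by rewrite dotpDl dotpNl. Qed.

Lemma dotp0l x : dotp 0 x = 0.
Proof. by rewrite -(scale0r x) dotpZl mul0r. Qed.

Lemma dotpDr u v x : dotp x (u + v) = dotp x u + dotp x v.
Proof. by rewrite !(dotpC x) dotpDl. Qed.

Lemma dotpZr a u x : dotp x (a *: u) = a * dotp x u.
Proof. by rewrite !(dotpC x) dotpZl. Qed.

Lemma dotpNr u x : dotp x (- u) = - dotp x u.
Proof. by rewrite !(dotpC x) dotpNl. Qed.

Lemma dotpBr u v x : dotp x (u - v) = dotp x u - dotp x v.
Proof. by rewrite !(dotpC x) dotpBl. Qed.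

Lemma dotp0r x : dotp x 0 = 0.
Proof. by rewrite dotpC dotp0l. Qed.

Definition dotpE :=
  (dotpDl, dotpDr, dotpNl, dotpNr, dotpZl, dotpZr, dotp0l, dotp0r).

Lemma dotp_suml (I : Type) (r : seq I) (P : pred I) (F : I -> 'cV[R]_n) x :
  dotp (\sum_(i <- r | P i) F i) x = \sum_(i <- r | P i) dotp (F i) x.
Proof.
by elim/big_rec2: _ => [|i a b _ <-]; rewrite ?dotp0l ?dotpDl.
Qed.

Lemma dotp_ge0 x : 0 <= dotp x x.
Proof. by apply: sumr_ge0 => i _; rewrite -expr2 sqr_ge0. Qed.

Lemma enorm_ge0 x : 0 <= enorm x.
Proof. exact: sqrtr_ge0. Qed.

Lemma enorm_sq x : enorm x ^+ 2 = dotp x x.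
Proof. by rewrite sqr_sqrtr // dotp_ge0. Qed.

Lemma normr_le_enorm x i : `|x i 0| <= enorm x.
Proof.
rewrite -sqrtr_sqr ler_sqrt ?dotp_ge0 // /dotp (bigD1 i) //= expr2 lerDl.
by apply: sumr_ge0 => j _; rewrite -expr2 sqr_ge0.
Qed.

Lemma enorm0_eq0 x : enorm x = 0 -> x = 0.
Proof.
move=> x0; apply/colP => i; rewrite mxE; apply/eqP.
by rewrite -normr_le0 -x0 normr_le_enorm.
Qed.

Lemma enorm_gt0 x : x != 0 -> 0 < enorm x.
Proof.
by move=> x0; rewrite lt0r enorm_ge0 andbT; apply: contra x0 => /eqP/enorm0_eq0/eqP.
Qed.

Lemma enorm0 : enorm (0 : 'cV[R]_n) = 0.
Proof. by rewrite /enorm dotp0l sqrtr0. Qed.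

Lemma enormZ a x : enorm (a *: x) = `|a| * enorm x.
Proof.
by rewrite /enorm dotpZl dotpZr mulrA -expr2 sqrtrM ?sqr_ge0// sqrtr_sqr.
Qed.

Lemma enormN x : enorm (- x) = enorm x.
Proof. by rewrite -scaleN1r enormZ normrN1 mul1r. Qed.

Lemma enormB u v : enorm (u - v) = enorm (v - u).
Proof. by rewrite -opprB enormN. Qed.

Lemma sqrD_enorm u v :
  enorm (u + v) ^+ 2 = enorm u ^+ 2 + 2 * dotp u v + enorm v ^+ 2.
Proof. by rewrite !enorm_sq !dotpE (dotpC v u); ring. Qed.

Lemma sqrB_enorm u v :
  enorm (u - v) ^+ 2 = enorm u ^+ 2 - 2 * dotp u v + enorm v ^+ 2.
Proof. by rewrite !enorm_sq !dotpE (dotpC v u); ring. Qed.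

Lemma dotp_le_enorm u v : dotp u v <= enorm u * enorm v.
Proof.
have [->|u0] := eqVneq u 0; first by rewrite dotp0l enorm0 mul0r.
have [->|v0] := eqVneq v 0; first by rewrite dotp0r enorm0 mulr0.
have a0 := enorm_gt0 u0; have b0 := enorm_gt0 v0.
have := sqr_ge0 (enorm (enorm v *: u - enorm u *: v)).
rewrite sqrB_enorm !enormZ !dotpE !ger0_norm ?enorm_ge0//.
set a := enorm u in a0 *; set b := enorm v in b0 *; set d := dotp u v.
rewrite (_ : _ + _ = (2 * a * b) * (a * b - d)); last by ring.
by rewrite pmulr_rge0 ?subr_ge0// !mulr_gt0.
Qed.

Lemma normr_dotp u v : `|dotp u v| <= enorm u * enorm v.
Proof.
rewrite ler_norml dotp_le_enorm andbT lerNl -dotpNl.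
by rewrite (le_trans (dotp_le_enorm _ _))// enormN.
Qed.

Lemma enormD u v : enorm (u + v) <= enorm u + enorm v.
Proof.
rewrite -(@ler_pXn2r _ 2)// ?nnegrE ?addr_ge0 ?enorm_ge0// sqrD_enorm sqrrD.
by have := dotp_le_enorm u v; lra.
Qed.

Lemma enormBl u v : enorm (u - v) <= enorm u + enorm v.
Proof. by rewrite (le_trans (enormD _ _))// enormN. Qed.

Lemma enorm_dist u v : `|enorm u - enorm v| <= enorm (u - v).
Proof.
rewrite ler_norml; apply/andP; split.
  by have := enormD u (v - u); rewrite [u + _]addrC subrK -(enormB u); lra.
by have := enormD v (u - v); rewrite [v + _]addrC subrK; lra.
Qed.

Lemma enorm_sum (I : Type) (r : seq I) (P : pred I) (F : I -> 'cV[R]_n) :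
  enorm (\sum_(i <- r | P i) F i) <= \sum_(i <- r | P i) enorm (F i).
Proof.
elim/big_rec2: _ => [|i a b _ h]; first by rewrite enorm0.
by rewrite (le_trans (enormD _ _))// lerD2l.
Qed.

Lemma norm_le_enorm x : `|x| <= enorm x.
Proof.
rewrite [leLHS]mx_normrE; apply: bigmax_le => [|[i j] _ /=]; first exact: enorm_ge0.
by rewrite (ord1 j) normr_le_enorm.
Qed.

Lemma enorm_le_norm x : enorm x <= n%:R * `|x|.
Proof.
have xi i : `|x i 0| <= `|x|.
  rewrite [leRHS]mx_normrE.
  exact: (@le_bigmax _ _ _ 0 (fun p => `|x p.1 p.2|) (i, 0)).
rewrite -(@ler_pXn2r _ 2)// ?nnegrE ?enorm_ge0 ?mulr_ge0// enorm_sq /dotp.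
apply: (@le_trans _ _ (\sum_(i < n) `|x| ^+ 2)).
  apply: ler_sum => i _; rewrite -expr2 -[leLHS]ger0_norm ?sqr_ge0// normrX.
  by rewrite lerXn2r ?nnegrE.
rewrite sumr_const card_ord exprMn -[leLHS]mulr_natl ler_wpM2r ?sqr_ge0//.
by rewrite -natrX ler_nat; case: (n) => // k; rewrite expnS leq_pmulr// expn_gt0.
Qed.

(** Columns carry the topology of the sup norm, which is equivalent to the
    Euclidean one. *)
Lemma cvg_enormP (T : Type) (F : set_system T) {FF : Filter F}
    (h : T -> 'cV[R]_n) x :
  (h @ F --> x) <-> (fun t => enorm (h t - x)) @ F --> 0.
Proof.
split=> [/cvgr_distC_lt hx|/cvgr0_norm_lt h0].
  apply/cvgr0Pnorm_lt => e e0.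
  have e1 : 0 < e / n.+1%:R by rewrite divr_gt0.
  apply: filterS (hx _ e1) => t ht; rewrite ger0_norm ?enorm_ge0//.
  rewrite (le_lt_trans (enorm_le_norm _))//.
  move: ht; rewrite ltr_pdivlMr// => /(le_lt_trans _); apply.
  by rewrite mulrC ler_wpM2l// ler_nat.
apply/cvgrPdistC_lt => e e0.
apply: filterS (h0 _ e0) => t; rewrite ger0_norm ?enorm_ge0//.
exact: le_lt_trans (norm_le_enorm _).
Qed.

End Euclid.

Lemma cvg_coord (R : realType) (n m : nat) (h : nat -> 'M[R]_(n, m))
    (x : 'M[R]_(n, m)) (i : 'I_n) (j : 'I_m) :
  h @ \oo --> x -> (fun t => h t i j) @ \oo --> x i j.
Proof.
move=> hx; apply: (continuous_cvg _ (h := fun M : 'M[R]_(n, m) => M i j)) hx.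
exact: coord_continuous.
Qed.
Arguments cvg_coord {R n m h x} i j.

Lemma cvg_enorm (R : realType) (n : nat) (h : nat -> 'cV[R]_n) (x : 'cV[R]_n) :
  h @ \oo --> x -> (fun t => enorm (h t)) @ \oo --> enorm x.
Proof.
move=> /cvg_enormP/cvgr0_norm_lt hx; apply/cvgrPdist_lt => e e0.
apply: filterS (hx _ e0) => t; rewrite ger0_norm ?enorm_ge0// distrC.
exact: le_lt_trans (enorm_dist _ _).
Qed.

Lemma dotp_mulmx (R : realType) (n m : nat) (A : 'M[R]_(m, n)) x y :
  dotp (A *m x) y = dotp x (A^T *m y).
Proof.
rewrite /dotp; under eq_bigr do rewrite mxE mulr_suml.
rewrite exchange_big /=; apply: eq_bigr => j _; rewrite mxE mulr_sumr.
by apply: eq_bigr => i _; rewrite mxE; ring.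
Qed.

Lemma enorm_mulmx_bounded (R : realType) (n m : nat) (A : 'M[R]_(m, n)) :
  exists2 c, 0 <= c & forall x, enorm (A *m x) <= c * enorm x.
Proof.
exists (\sum_j enorm (col j A)) => [|x].
  by apply: sumr_ge0 => j _; exact: enorm_ge0.
have -> : A *m x = \sum_j x j 0 *: col j A.
  apply/colP => i; rewrite mxE summxE; apply: eq_bigr => j _.
  by rewrite !mxE mulrC.
rewrite (le_trans (enorm_sum _ _ _))// mulr_suml; apply: ler_sum => j _.
by rewrite enormZ mulrC ler_wpM2l ?enorm_ge0// normr_le_enorm.
Qed.

Lemma common_radius (R : realType) (I : finType) (T : Type) (d : T -> R)
    (Q : I -> T -> Prop) :
  (forall i, exists2 e, 0 < e & forall t, d t < e -> Q i t) ->
  exists2 e, 0 < e & forall t, d t < e -> forall i, Q i t.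
Proof.
move=> QE; have /choice[e eE] i : exists e, 0 < e /\ forall t, d t < e -> Q i t.
  by have [e e0 Qe] := QE i; exists e.
exists (\big[Num.min/1]_i e i).
  by elim/big_ind: _ => // [x y x0 y0|i _]; [rewrite lt_min x0|case: (eE i)].
move=> t te i; have [_] := eE i; apply; apply: (lt_le_trans te).
exact: bigmin_le_cond.
Qed.

Lemma enorm_trmx_le (R : realType) (n m : nat) (A : 'M[R]_(m, n)) (c : R) :
  0 <= c -> (forall x, enorm (A *m x) <= c * enorm x) ->
  forall y, enorm (A^T *m y) <= c * enorm y.
Proof.
move=> c0 Ac y; have [z0|z0] := eqVneq (A^T *m y) 0.
  by rewrite z0 enorm0 mulr_ge0 ?enorm_ge0.
rewrite -(ler_pM2r (enorm_gt0 z0)) -expr2 enorm_sq -dotp_mulmx.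
rewrite (le_trans (dotp_le_enorm _ _))// mulrAC ler_wpM2r ?enorm_ge0//.
Qed.

(** * The conjugate gradient algorithm *)

Section ConjugateGradientConvergence.
Context {R : realType} {m : nat}.
Variables (V : 'M[R]_m) (c : 'cV[R]_m) (L : R).
Hypotheses (V_sym : V^T = V) (V_ge : forall x, dotp x x <= dotp (V *m x) x).
Hypothesis V_le : forall x, dotp (V *m x) x <= L * dotp x x.
Implicit Types x r q : 'cV[R]_m.

(** Its minimizer is the solution of V x = c. *)
Definition energy x : R := 2^-1 * dotp (V *m x) x - dotp c x.

Lemma dotp_symC x r : dotp (V *m x) r = dotp (V *m r) x.
Proof. by rewrite dotp_mulmx V_sym dotpC. Qed.

Lemma energy_ge x : - (2^-1 * dotp c c) <= energy x.
Proof.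
have := dotp_ge0 (x - c); rewrite !dotpE (dotpC x c) /energy.
by have := V_ge x; lra.
Qed.

Lemma energyD x q (a : R) :
  energy (x + a *: q) =
  energy x - a * dotp (c - V *m x) q + 2^-1 * a ^+ 2 * dotp (V *m q) q.
Proof.
rewrite /energy mulmxDr -scalemxAr !dotpE (dotp_symC q x); by field.
Qed.

(** The direction q is conjugate to the previous one, from which r differs by a
    multiple; this is expressed by the last two conditions in terms of the current
    state alone. *)
Definition cg_invariant (s : 'cV[R]_m * 'cV[R]_m * 'cV[R]_m) :=
  let: (x, r, q) := s in
  [/\ r = c - V *m x, dotp r q = dotp r r,
      dotp (V *m q) r = dotp (V *m q) q &
      dotp (V *m q) q <= dotp (V *m r) r].

Lemma dotp_eq0 q : dotp q q <= 0 -> q = 0.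
Proof.
move=> q0; apply: enorm0_eq0; apply/eqP; rewrite -sqrf_eq0 enorm_sq.
by rewrite eq_le q0 dotp_ge0.
Qed.

Lemma cg_step_invariant s : cg_invariant s -> cg_invariant (cg_step V s).
Proof.
case: s => [[x r] q] [rE rq Vqr qr] /=; rewrite (dotpC q (V *m q)).
have [r0|r0] := eqVneq r 0.
  have -> : q = 0.
    by apply: dotp_eq0; rewrite (le_trans (V_ge _))// (le_trans qr)// r0 dotp0r.
  rewrite r0 /= !(dotp0r, dotp0l, mul0r, mulmx0, scale0r, scaler0, subr0, addr0).
  by rewrite -r0.
have rr : 0 < dotp r r.
  rewrite lt0r dotp_ge0 andbT; apply: contra r0 => /eqP h.
  by rewrite (@dotp_eq0 r) ?h.
have qq : 0 < dotp q q.
  rewrite lt0r dotp_ge0 andbT; apply: contraTN rr => /eqP h.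
  by rewrite -rq (@dotp_eq0 q) ?dotp0r ?ltxx// h.
have Vqq : 0 < dotp (V *m q) q by rewrite (lt_le_trans qq).
set D := dotp (V *m q) q in Vqr qr Vqq *; set rho := dotp r r in rq rr *.
have rho0 : rho != 0 by rewrite gt_eqF.
have D0 : D != 0 by rewrite gt_eqF.
set a := rho / D; set r' := r - a *: (V *m q).
set beta := dotp r' r' / rho.
have r'q : dotp r' q = 0.
  by rewrite /r' !dotpE -/D rq /a; field.
have r'r : dotp r' r = 0.
  by rewrite /r' !dotpE -/rho Vqr /a; field.
have VqE : V *m q = a^-1 *: (r - r').
  rewrite /r' opprB addrC subrK scalerA mulVf ?scale1r//.
  by rewrite mulf_neq0 ?invr_neq0.
have r'E : r' = r - a *: (V *m q) by [].
clearbody r'.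
have Vqr' : dotp (V *m q) r' = - (beta * D).
  rewrite VqE dotpZl dotpBl (dotpC r) r'r /beta /a; field.
  by rewrite rho0 D0.
have Vqq' : dotp (V *m q) (r' + beta *: q) = 0.
  by rewrite !dotpE Vqr' -/D; ring.
have Vq'q : dotp (V *m (r' + beta *: q)) q = 0 by rewrite dotp_symC.
split.
- by rewrite r'E rE mulmxDr -scalemxAr opprD addrA.
- by rewrite !dotpE r'q; ring.
- by rewrite !dotpE Vq'q mulr0 addr0.
- rewrite [X in _ <= X](_ : _ = dotp (V *m (r' + beta *: q)) (r' + beta *: q)
     + beta ^+ 2 * D); last first.
    rewrite dotpDr dotpZr Vq'q mulr0 addr0 mulmxDr -scalemxAr !dotpE Vqr'; ring.
  by rewrite lerDl mulr_ge0 ?sqr_ge0// ltW.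
Qed.

(** A step is an exact line search along q.  It gains half of
    <r, r>^2 / <Vq, q>, and <Vq, q> <= <Vr, r> <= L <r, r>. *)
Lemma cg_step_energy x r q : cg_invariant (x, r, q) ->
  L * (energy x - energy (cg_step V (x, r, q)).1.1) >= 2^-1 * dotp r r.
Proof.
move=> [rE rq Vqr qr] /=; rewrite energyD -rE rq (dotpC q (V *m q)).
have [q0|q0] := eqVneq (dotp (V *m q) q) 0.
  rewrite q0 (_ : dotp r r = 0) ?(mul0r, mulr0, subr0, addr0, subrr)//.
  by rewrite -rq (@dotp_eq0 q) ?dotp0r// -q0.
have D0 : 0 < dotp (V *m q) q.
  by rewrite lt0r q0 (le_trans (dotp_ge0 q)).
have -> : energy x - (energy x - dotp r r / dotp (V *m q) q * dotp r r +
   2^-1 * (dotp r r / dotp (V *m q) q) ^+ 2 * dotp (V *m q) q) =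
   2^-1 * dotp r r * (dotp r r / dotp (V *m q) q) by field.
rewrite mulrCA ler_peMr ?mulr_ge0 ?dotp_ge0 ?invr_ge0//.
by rewrite mulrA ler_pdivlMr// mul1r (le_trans qr).
Qed.

Lemma cg_iter_invariant k : cg_invariant (iter k (cg_step V) (0, c, c)).
Proof.
elim: k => [|k IH]; last exact: cg_step_invariant.
by rewrite /= mulmx0 subr0.
Qed.

Hypothesis L_gt0 : 0 < L.

(** The algorithm starts at 0, where the energy vanishes. *)
Lemma cg_energy_le0 k : energy (cg_iterate V c k) <= 0.
Proof.
rewrite /cg_iterate; elim: k => [|k IH].
  by rewrite /= /energy mulmx0 !dotpE; lra.
have := cg_iter_invariant k; rewrite iterS.
case: (iter _ _ _) IH => [[x r] q] /= IH inv.
have := cg_step_energy inv; rewrite /= => h.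
rewrite (le_trans _ IH)// -subr_ge0 -(pmulr_rge0 _ L_gt0) (le_trans _ h)//.
by rewrite mulr_ge0 ?dotp_ge0.
Qed.

(** The energy is bounded below and each step lowers it by a fixed multiple of
    the squared residual, so that the residual cannot stay away from 0. *)
Lemma cg_reaches (e : R) : 0 < e ->
  exists k, enorm (V *m cg_iterate V c k - c) <= e.
Proof.
move=> e0; apply: contrapT => /forallNP far.
have drop k : energy (cg_iterate V c k) <= - (k%:R * (e ^+ 2 / (2 * L))).
  elim: k => [|k IH]; first by rewrite mul0r oppr0 cg_energy_le0.
  have /negP := far k; rewrite -ltNge.
  have := cg_iter_invariant k; rewrite /cg_iterate iterS in IH *.
  case: (iter _ _ _) IH => [[x r] q] /= IH inv far_k.
  have := cg_step_energy inv; rewrite /= => h.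
  have er : e ^+ 2 <= dotp r r.
    rewrite -enorm_sq lerXn2r ?nnegrE ?enorm_ge0 ?ltW//.
    by case: inv => -> *; rewrite enormB.
  rewrite -(ler_pM2l L_gt0).
  have -> : L * - (k.+1%:R * (e ^+ 2 / (2 * L))) =
    L * - (k%:R * (e ^+ 2 / (2 * L))) - 2^-1 * e ^+ 2.
    by rewrite -natr1; field; rewrite gt_eqF.
  have := ler_pM2l L_gt0 (energy x) (- (k%:R * (e ^+ 2 / (2 * L)))).
  rewrite IH; nra.
have e2 : 0 < e ^+ 2 / (2 * L) by rewrite divr_gt0 ?exprn_gt0 ?mulr_gt0.
have [k hk] : exists k : nat, 2^-1 * dotp c c / (e ^+ 2 / (2 * L)) < k%:R.
  eexists; apply: archi_boundP; apply: divr_ge0 (ltW e2).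
  by rewrite mulr_ge0 ?dotp_ge0.
have := drop k; have := energy_ge (cg_iterate V c k).
by rewrite ltr_pdivrMr// in hk; lra.
Qed.

End ConjugateGradientConvergence.

(** * The semismooth Newton method for a strongly convex function *)

Lemma grad_quadratic (R : realType) (m : nat) (f : 'cV[R]_m -> R) y g (C : R) :
  (forall h, `|f (y + h) - f y - dotp g h| <= C * enorm h ^+ 2) ->
  grad f y = g.
Proof.
move=> fE; apply/colP => i; rewrite mxE.
set v : 'cV[R]_m := delta_mx i 0.
have gv : dotp g v = g i 0.
  rewrite /dotp (bigD1 i) //= big1 ?addr0 => [|j ji].
    by rewrite !mxE !eqxx mulr1.
  by rewrite !mxE (negPf ji) mulr0.
have C0 : 0 <= C * enorm v ^+ 2 by rewrite (le_trans _ (fE v)).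
apply: cvg_lim => //; rewrite -gv; apply/cvgrPdist_le => e e0.
have De : 0 < e / (C * enorm v ^+ 2 + 1) by rewrite divr_gt0 // ltr_wpDl.
near=> t.
have t0 : t != 0 by near: t; exact: nbhs_dnbhs_neq.
have te : `|t| <= e / (C * enorm v ^+ 2 + 1).
  by near: t; apply: dnbhs0_le.
rewrite /= [_ *: _]mulrC [t *: v + y]addrC distrC.
have -> : (f (y + t *: v) - f y) * t^-1 - dotp g v =
   t^-1 * (f (y + t *: v) - f y - dotp g (t *: v)).
  by rewrite dotpZr; field.
rewrite normrM normfV ler_pdivrMl ?normr_gt0// (le_trans (fE _))//.
rewrite enormZ exprMn real_normK ?num_real//.
rewrite -[t ^+ 2]real_normK ?num_real// expr2 mulrCA -mulrA ler_wpM2l//.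
rewrite (le_trans (y := `|t| * (C * enorm v ^+ 2 + 1)))//.
  by rewrite ler_wpM2l// lerDl.
by rewrite -ler_pdivlMr// ltr_wpDl.
Unshelve. all: by end_near. Qed.

(** The exponent 1 + tau makes the requested accuracy a fixed fraction of the
    gradient, both for large gradients (through eta) and for small ones. *)
Lemma newton_tolerance (R : realType) (eta tau : R) :
  0 < eta < 1 -> 0 < tau ->
  exists2 rho, 0 <= rho < 1 &
    forall t, 0 <= t -> Num.min eta (t `^ (1 + tau)) <= rho * t.
Proof.
move=> /andP[e0 e1] tau0; set s := Num.sqrt eta.
have s0 : 0 <= s by exact: sqrtr_ge0.
have s1 : s < 1 by rewrite -[ltRHS]sqrtr1 ltr_sqrt.
have st1 : s `^ tau < 1.
  by have := gt0_ltr_powR tau0 s0 ler01 s1; rewrite powR1.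
exists (Num.max s (s `^ tau)).
  by rewrite le_max s0 /= gt_max s1 st1.
move=> t t0; have [st|ts] := leP s t.
  rewrite ge_min; apply/orP; left.
  rewrite -[leLHS](sqr_sqrtr (ltW e0)) -/s expr2.
  rewrite (le_trans (y := s * t)) ?ler_wpM2l// ler_wpM2r//.
  by rewrite le_max lexx.
rewrite ge_min; apply/orP; right.
have [->|tn0] := eqVneq t 0.
  by rewrite mulr0 powR0// gt_eqF// addr_gt0.
rewrite powRD; last by rewrite tn0 implybT.
rewrite powRr1// mulrC ler_wpM2r// le_max; apply/orP; right.
by apply: ge0_ler_powR; rewrite ?nnegrE// ltW.
Qed.

Section NewtonGlobal.
Context {R : realType} {m : nat}.
Variables (f : 'cV[R]_m -> R) (g : 'cV[R]_m -> 'cV[R]_m).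
Variables (Vs : 'cV[R]_m -> set 'M[R]_m) (L mu eta tau delta : R).
Implicit Types (y z d : 'cV[R]_m) (V : 'M[R]_m).

Hypotheses (mu_gt0 : 0 < mu) (mu_lt : mu < 1 / 2) (eta_range : 0 < eta < 1).
Hypotheses (tau_gt0 : 0 < tau) (tau_le1 : tau <= 1).
Hypotheses (delta_gt0 : 0 < delta) (delta_lt1 : delta < 1) (L_ge1 : 1 <= L).
Hypothesis f_lower : forall y z,
  f y + dotp (g y) (z - y) + 2^-1 * enorm (z - y) ^+ 2 <= f z.
Hypothesis f_upper : forall y z,
  f z <= f y + dotp (g y) (z - y) + L / 2 * enorm (z - y) ^+ 2.
Hypothesis g_lip : forall y z, enorm (g y - g z) <= L * enorm (y - z).
Hypothesis Vs_neq0 : forall y, Vs y !=set0.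
Hypothesis Vs_sym : forall y V, Vs y V -> V^T = V.
Hypothesis Vs_ge : forall y V, Vs y V -> forall x, dotp x x <= dotp (V *m x) x.
Hypothesis Vs_le : forall y V, Vs y V ->
  forall x, dotp (V *m x) x <= L * dotp x x.

Let L_gt0 : 0 < L. Proof. exact: lt_le_trans L_ge1. Qed.
Let mu_lt1 : mu < 1. Proof. by move: mu_lt; lra. Qed.

Lemma grad_f y : grad f y = g y.
Proof.
apply: (@grad_quadratic _ _ _ _ _ (L / 2)) => h.
have := f_lower y (y + h); have := f_upper y (y + h); rewrite (addrC y h) addrK.
have e2 : 0 <= enorm h ^+ 2 by exact: sqr_ge0.
have LL : 0 <= L / 2 * enorm h ^+ 2 by rewrite mulr_ge0// ltW// divr_gt0.
by rewrite ler_norml => ? ?; apply/andP; split; lra.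
Qed.

(** This is the positivity of V at the point x - V x / L. *)
Lemma mulmx_sqr_le y V x : Vs y V -> enorm (V *m x) ^+ 2 <= L * dotp (V *m x) x.
Proof.
move=> yV; have := le_trans (dotp_ge0 _) (Vs_ge yV (x - L^-1 *: (V *m x))).
have := Vs_le yV (V *m x).
rewrite enorm_sq mulmxBr -scalemxAr !dotpE.
rewrite (dotp_symC (Vs_sym yV) (V *m x) x).
set a := dotp (V *m x) x; set b := dotp (V *m x) (V *m x).
set c := dotp (V *m (V *m x)) _ => cb h.
have h' : 0 <= L ^+ 2 * a - 2 * L * b + c.
  have -> : L ^+ 2 * a - 2 * L * b + c =
    L ^+ 2 * (a - L^-1 * b - (L^-1 * b - L^-1 * (L^-1 * c))).
    by field; rewrite gt_eqF.
  apply: mulr_ge0; first exact: sqr_ge0.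
  by lra.
have : 0 <= L * (L * a - b) by lra.
by rewrite pmulr_rge0// subr_ge0.
Qed.

Lemma enorm_mulmx_ge y V x : Vs y V -> enorm x <= enorm (V *m x).
Proof.
move=> yV; have [->|x0] := eqVneq x 0; first by rewrite enorm0 enorm_ge0.
rewrite -(ler_pM2r (enorm_gt0 x0)) (le_trans _ (dotp_le_enorm _ _))//.
by rewrite -expr2 enorm_sq (Vs_ge yV).
Qed.

Lemma Vs_unit y V : Vs y V -> V \in unitmx.
Proof.
move=> yV; rewrite -unitmx_tr -row_free_unit -kermx_eq0.
apply/eqP/row_matrixP => i; rewrite row0; set r := row i _.
have /(congr1 trmx) : r *m V^T = 0.
  by rewrite /r -row_mul mulmx_ker row0.
rewrite trmx_mul trmxK trmx0 => Vr.
apply: trmx_inj; rewrite trmx0; apply: enorm0_eq0; apply/eqP.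
by rewrite eq_le enorm_ge0 andbT (le_trans (enorm_mulmx_ge _ yV))// Vr enorm0.
Qed.

(** With c = - g y, an exact solution satisfies <c, d> = <Vd, d>, and a conjugate
    gradient iterate has nonpositive energy, which is the same up to a factor 2. *)
Lemma direction_descent y V d : Vs y V -> newton_direction f eta tau y V d ->
  dotp (g y) d <= - (2^-1 * dotp (V *m d) d).
Proof.
move=> yV; have Vd0 := le_trans (dotp_ge0 d) (Vs_ge yV d).
rewrite /newton_direction grad_f => -[[Vd|[k ->]] _].
  by move: Vd0; rewrite Vd dotpNl; lra.
have := cg_energy_le0 (- g y) (Vs_sym yV) (Vs_ge yV) (Vs_le yV) L_gt0 k.
by rewrite /energy dotpNl; lra.
Qed.

Lemma direction_descent_sqr y V d :
  Vs y V -> newton_direction f eta tau y V d ->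
  dotp (g y) d <= - (2^-1 * dotp d d).
Proof.
by move=> yV /(direction_descent yV); have := Vs_ge yV d; lra.
Qed.

Lemma armijo_small y d k : dotp (g y) d <= - (2^-1 * dotp d d) ->
  L * delta ^+ k <= 1 - mu -> armijo f mu delta y d k.
Proof.
move=> gd kL; have := f_upper y (y + delta ^+ k *: d).
rewrite /armijo grad_f (addrC y) addrK dotpZr enormZ exprMn.
rewrite real_normK ?num_real// enorm_sq; set t := delta ^+ k in kL *.
have t0 : 0 <= t by rewrite exprn_ge0// ltW.
have dd := dotp_ge0 d.
move=> h; apply: (le_trans h); rewrite -addrA lerD2l.
have : 0 <= t * (2^-1 * dotp d d * (1 - mu - L * t)).
  by rewrite !mulr_ge0// subr_ge0.
have : 0 <= t * ((1 - mu) * (- (2^-1 * dotp d d) - dotp (g y) d)).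
  by rewrite !mulr_ge0// ?subr_ge0// ltW.
by lra.
Qed.

Lemma armijo_index_exists y d : dotp (g y) d <= - (2^-1 * dotp d d) ->
  exists k, armijo_index f mu delta y d k.
Proof.
move=> gd.
have [k0 k0L] : exists k, L * delta ^+ k <= 1 - mu.
  have : (fun k => delta ^+ k : R^o) @ \oo --> (0 : R^o).
    by apply: cvg_expr; rewrite ger0_norm// ltW.
  move=> /cvgr0_norm_le/(_ ((1 - mu) / L)) [|k _ /(_ k (leqnn k))/=].
    by rewrite divr_gt0// subr_gt0.
  rewrite ger0_norm ?exprn_ge0 ?(ltW delta_gt0)// ler_pdivlMr// mulrC => ?.
  by exists k.
have ex : exists k, `[< armijo f mu delta y d k >].
  by exists k0; apply/asboolP; exact: armijo_small.
case: (ex_minnP ex) => k /asboolP ak kmin; exists k; split=> // i ik ai.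
by move: ik; rewrite ltnNge kmin//; apply/asboolP.
Qed.

(** Unless k = 0, the line search has rejected the larger step delta ^+ k.-1. *)
Lemma armijo_index_step y d k : dotp (g y) d <= - (2^-1 * dotp d d) ->
  armijo_index f mu delta y d k -> delta * (1 - mu) / L <= delta ^+ k.
Proof.
move=> gd [_ kmin]; rewrite ler_pdivrMr//.
case: k kmin => [_|k /(_ k (ltnSn k)) nk].
  by rewrite expr0 mul1r (le_trans _ L_ge1)// mulr_ile1 ?subr_ge0 ?gerBl// ltW.

rewrite exprS -mulrA ler_pM2l// mulrC leNgt; apply/negP => h.
by apply: nk; apply: armijo_small => //; exact: ltW.
Qed.

Lemma ssn_well_definedP : ssn_well_defined f Vs mu eta tau delta.
Proof.
move=> y; split=> [|V yV|V d yV dir]; first exact: Vs_neq0.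
  split; first by exists (invmx V *m - grad f y); rewrite mulKVmx// (Vs_unit yV).
  rewrite grad_f; have [g0|g0] := eqVneq (g y) 0.
    exists 0%N; rewrite /newton_accurate grad_f g0 addr0 /cg_iterate /= mulmx0.
    by rewrite enorm0 le_min powR_ge0 andbT; case/andP: eta_range => /ltW.
  pose e := Num.min eta (enorm (g y) `^ (1 + tau)).
  have e0 : 0 < e.
    rewrite lt_min; case/andP: eta_range => -> _ /=.
    by rewrite powR_gt0// enorm_gt0.
  have [k hk] := cg_reaches (- g y) (Vs_sym yV) (Vs_ge yV) (Vs_le yV) L_gt0 e0.
  by exists k; move: hk; rewrite /newton_accurate grad_f opprK.
exact/armijo_index_exists/(direction_descent_sqr yV).
Qed.

Lemma ssn_sequence_exists y0 :
  exists y : nat -> 'cV[R]_m, ssn_sequence f Vs mu eta tau delta y0 y.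
Proof.
have step y : exists y', ssn_step f Vs mu eta tau delta y y'.
  have [[V yV] sol ls] := ssn_well_definedP y.
  have [_ [k acc]] := sol _ yV.
  have dir : newton_direction f eta tau y V (cg_iterate V (- grad f y) k).
    by split=> //; right; exists k.
  have [j aj] := ls _ _ yV dir.
  by eexists; exists V, (cg_iterate V (- grad f y) k), j; split.
have [F FE] := choice step.
by exists (fun j => iter j F y0); split=> // j; rewrite iterS.
Qed.

(** The two quadratic bounds squeeze f near y. *)
Lemma f_continuous : continuous f.
Proof.
move=> y; have FF : Filter (nbhs y) by exact: (@nbhs_filter 'cV[R]_m y).
have e0 : enorm (z - y) @[z --> y] --> (0 : R).
  have idc : idfun z @[z --> y] --> y by exact: cvg_id.
  by move/cvg_enormP: idc.
have b0 (C : R) : dotp (g y) (z - y) + C * enorm (z - y) ^+ 2 @[z --> y] --> (0:R).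
  have H : enorm (g y) * enorm (z - y) + `|C| * (enorm (z - y) * enorm (z - y))
    @[z --> y] --> (0 : R).
    have := cvgD (cvgM (cvg_cst (enorm (g y))) e0)
                 (cvgM (cvg_cst `|C|) (cvgM e0 e0)).
    rewrite !mulr0 addr0; exact.
  apply/cvgr0Pnorm_lt => e e_gt0; move/cvgr0_norm_lt: H => /(_ e e_gt0).
  apply: filterS => z; apply: le_lt_trans.
  rewrite (le_trans _ (ler_norm _))// (le_trans (ler_normD _ _))//.
  by rewrite lerD ?normr_dotp// normrM -expr2 (ger0_norm (sqr_ge0 _)).
have fl : f y + (dotp (g y) (z - y) + 2^-1 * enorm (z - y) ^+ 2) @[z --> y] --> f y.
  by rewrite -[X in _ --> X]addr0; apply: cvgD; [exact: cvg_cst|exact: b0].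
have fu :
    f y + (dotp (g y) (z - y) + L / 2 * enorm (z - y) ^+ 2) @[z --> y] --> f y.
  by rewrite -[X in _ --> X]addr0; apply: cvgD; [exact: cvg_cst|exact: b0].
apply: (squeeze_cvgr _ fl fu).
by near=> z; rewrite !addrA f_lower f_upper.
Unshelve. all: by end_near. Qed.

Lemma minimizer_g0 y : is_minimizer f y -> g y = 0.
Proof.
move=> ymin; apply: enorm0_eq0; apply/eqP; rewrite -sqrf_eq0.
have := f_upper y (y - L^-1 *: g y).
rewrite (addrC y) addrK enormN enormZ dotpNr dotpZr exprMn.
rewrite real_normK ?num_real// -enorm_sq => h.
have := le_trans (ymin _) h; set a := enorm _ ^+ 2.
have -> : f y + - (L^-1 * a) + L / 2 * (L^-1 ^+ 2 * a) = f y - a / (2 * L).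
  by field; rewrite gt_eqF.
rewrite -subr_ge0 [_ - f y]addrAC subrr add0r oppr_ge0.
rewrite pmulr_lle0 ?invr_gt0 ?mulr_gt0// => a0.
by rewrite eq_le a0 sqr_ge0.
Qed.

Lemma g0_unique y z : g y = 0 -> is_minimizer f z -> z = y.
Proof.
move=> gy zmin; have := f_lower y z; rewrite gy dotp0l addr0 => h.
apply/eqP; rewrite -subr_eq0; apply/eqP; apply: dotp_eq0.
by rewrite -enorm_sq; have := zmin y; lra.
Qed.

Lemma minimizer_exists : exists y, is_minimizer f y.
Proof.
pose F (v : 'rV[R]_m) : R := f v^T.
have trc : continuous (fun v : 'rV[R]_m => v^T).
  move=> v; have FF : Filter (nbhs v) by exact: (@nbhs_filter 'rV[R]_m v).
  apply/cvgrPdist_lt => e e0.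
  have /cvgrPdist_lt/(_ e e0) : z @[z --> v] --> v by exact: cvg_id.
  apply: filterS => z; apply: le_lt_trans.
  rewrite -linearB /= [leLHS]mx_normrE.
  apply: bigmax_le => [//|[i j] _ /=]; rewrite mxE.
  rewrite [leRHS]mx_normrE.
  exact: (@le_bigmax _ _ _ 0 (fun p => `|(v - z) p.1 p.2|) (j, i)).
have Fc : continuous F.
  by move=> v; apply: continuous_comp; [exact: trc|exact: f_continuous].
pose S := [set v | F v <= F 0].
have cS : compact S.
  apply: bounded_closed_compact.
    exists (2 * enorm (g 0)); split; first exact: num_real.
    move=> M gM v Sv.
    have vM : enorm v^T <= 2 * enorm (g 0).
      have := f_lower 0 v^T; rewrite subr0 => h.
      have h2 : 2^-1 * enorm v^T ^+ 2 <= enorm (g 0) * enorm v^T.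
        have := normr_dotp (g 0) v^T; rewrite ler_norml => /andP[h3 _].
        by move: Sv; rewrite /S /F /= trmx0; lra.
      have [->|v0] := eqVneq (enorm v^T) 0; first by rewrite mulr_ge0 ?enorm_ge0.
      have v1 : 0 < enorm v^T by rewrite lt0r v0 enorm_ge0.
      by rewrite -(ler_pM2r v1); move: h2; rewrite expr2; lra.
    apply: le_trans (ltW gM); apply: le_trans vM.
    rewrite [leLHS]mx_normrE; apply: bigmax_le => [|[i j] _ /=].
      exact: enorm_ge0.
    by rewrite (ord1 i) -(mxE trmx_key (fun i j => v j i)) normr_le_enorm.
  rewrite (_ : S = F @^-1` [set x | x <= F 0])//.
  by apply: closed_comp => [v _|]; [exact: Fc|exact: closed_le].
have [|v _ vmin] := EVT_min_rV _ cS (continuous_subspaceT Fc).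
  by exists 0; rewrite /S /=.
exists v^T => z.
have [zS|/negP zS] := boolP (f z <= F 0).
  have := vmin z^T; rewrite /F trmxK; apply; rewrite inE /S /F /= trmxK; exact: zS.
move/negP: zS; rewrite -ltNge => /ltW; apply: le_trans.
by apply: vmin; rewrite inE /S /=.
Qed.

Section Convergence.
Variables (ybar : 'cV[R]_m) (gybar : g ybar = 0).

Lemma sqr_dist_le y : enorm (y - ybar) ^+ 2 <= 2 * (f y - f ybar).
Proof. by have := f_lower ybar y; rewrite gybar dotp0l addr0; lra. Qed.

(** The quadratic lower bound at y is minimized in closed form. *)
Lemma gap_le y : 2 * (f y - f ybar) <= enorm (g y) ^+ 2.
Proof.
have := f_lower y ybar; have := sqr_ge0 (enorm (g y + (ybar - y))).
by rewrite (sqrD_enorm (g y)); lra.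
Qed.

(** A step decreases f by a fixed multiple of |g y|^2: the step size is bounded
    below, <g, d> <= - <Vd, d> / 2 <= - |Vd|^2 / (2 L), and |Vd| is at least
    (1 - rho) |g| by the accuracy of d.  The gap is at most |g y|^2 / 2. *)
Lemma ssn_step_gap : exists2 q, 0 < q < 1 &
  forall y y', ssn_step f Vs mu eta tau delta y y' ->
    f y' - f ybar <= q * (f y - f ybar).
Proof.
have [rho /andP[rho0 rho1] tol] := newton_tolerance eta_range tau_gt0.
pose kap := delta * (1 - mu) / L.
have kap0 : 0 < kap by rewrite !mulr_gt0 ?invr_gt0// subr_gt0.
have kap1 : kap < 1.
  rewrite ltr_pdivrMr// mul1r (lt_le_trans _ L_ge1)//.
  by rewrite mulr_ilt1 ?subr_ge0 ?gtrBl// ltW.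
pose c := mu * kap * ((1 - rho) ^+ 2 / L).
have r2 : 0 < (1 - rho) ^+ 2 / L <= 1.
  rewrite divr_gt0 ?exprn_gt0 ?subr_gt0//= ler_pdivrMr// mul1r.
  by rewrite (le_trans _ L_ge1)// expr2 mulr_ile1 ?subr_ge0 ?gerBl// ltW.
have c0 : 0 < c by case/andP: r2 => r20 _; rewrite mulr_gt0// mulr_gt0.
have c1 : c < 1.
  case/andP: r2 => r20 r21; rewrite /c.
  apply: (le_lt_trans (y := mu * kap)); last by rewrite mulr_ilt1// ltW.
  by rewrite ger_pMr// mulr_gt0.
exists (1 - c); first by apply/andP; split; lra.
move=> y _ [V [d [k [yV dir ak ->]]]].
have dsq := direction_descent_sqr yV dir.
have step := armijo_index_step dsq ak; have [ak1 _] := ak.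
have Vd2 : (1 - rho) ^+ 2 / L * enorm (g y) ^+ 2 <= dotp (V *m d) d.
  rewrite mulrAC ler_pdivrMr// -exprMn [leRHS]mulrC.
  apply: le_trans (mulmx_sqr_le d yV).
  rewrite lerXn2r ?nnegrE ?mulr_ge0 ?enorm_ge0 ?subr_ge0 ?(ltW rho1)//.
  have [_] := dir; rewrite /newton_accurate grad_f => acc.
  have := le_trans acc (tol _ (enorm_ge0 _)).
  have := enormBl (V *m d + g y) (V *m d).
  by rewrite addrAC subrr add0r; lra.
have := direction_descent yV dir => dd.
move: ak1; rewrite /armijo grad_f.
have := gap_le y; set D := f y - f ybar => gl.
have gd : dotp (g y) d <= - ((1 - rho) ^+ 2 / L * D).
  case/andP: r2 => r20 _.
  have : (1 - rho) ^+ 2 / L * (2 * D) <= (1 - rho) ^+ 2 / L * enorm (g y) ^+ 2.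
    by rewrite ler_pM2l.
  by lra.
have D0 : 0 <= D.
  by have := sqr_dist_le y; rewrite -/D; have := sqr_ge0 (enorm (y - ybar)); lra.
have gd0 : dotp (g y) d <= 0.
  by have := dotp_ge0 d; lra.
have : mu * delta ^+ k * dotp (g y) d <= - (c * D).
  rewrite /c (le_trans (y := mu * kap * dotp (g y) d))//.
    by rewrite ler_wnM2r// ler_pM2l.
  by rewrite -[X in - X]mulrA -mulrN ler_pM2l// mulr_gt0.
by rewrite mulrBl mul1r /D; lra.
Qed.

Lemma ssn_cvg y0 (y : nat -> 'cV[R]_m) : ssn_sequence f Vs mu eta tau delta y0 y ->
  y @ \oo --> ybar.
Proof.
move=> [_ ys]; have [q /andP[q0 q1] gap] := ssn_step_gap.
have gapn j : f (y j) - f ybar <= q ^+ j * (f (y 0%N) - f ybar).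
  elim: j => [|j IH]; first by rewrite expr0 mul1r.
  by rewrite (le_trans (gap _ _ (ys j)))// exprS -mulrA ler_pM2l.
apply/cvg_enormP/cvgr0Pnorm_lt => e e0.
have : (fun j => geometric (2 * (f (y 0%N) - f ybar)) q j : R^o) @ \oo
    --> (0 : R^o).
  by apply: cvg_geometric; rewrite ger0_norm// ltW.
move=> /cvgr0_norm_lt/(_ (e ^+ 2) (exprn_gt0 _ e0)).
apply: filterS => j /=; rewrite (ger0_norm (enorm_ge0 _)) => ej.
rewrite -(@ltr_pXn2r _ 2)// ?nnegrE ?enorm_ge0 ?(ltW e0)//.
apply: le_lt_trans ej; apply: le_trans (ler_norm _).
apply: (le_trans (sqr_dist_le _)).
by have := gapn j; lra.
Qed.

Variables (K eps : R) (K_ge0 : 0 <= K) (eps_gt0 : 0 < eps).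
Hypothesis g_local : forall y V, enorm (y - ybar) < eps -> Vs y V ->
  enorm (g y - V *m (y - ybar)) <= K * enorm (y - ybar) ^+ 2.
Hypothesis f_local : forall y, enorm (y - ybar) < eps ->
  `|f y - f ybar - 2^-1 * dotp (g y) (y - ybar)| <= K * enorm (y - ybar) ^+ 3.

Let C := L `^ (1 + tau) + K.

(** With e = y - ybar, V (e + d) = (V d + g y) - (g y - V e): the residual of the
    linear system and the semismoothness error. *)
Lemma newton_step_local y V d : enorm (y - ybar) < eps -> enorm (y - ybar) <= 1 ->
  Vs y V -> newton_direction f eta tau y V d ->
  enorm (y + d - ybar) <= C * enorm (y - ybar) `^ (1 + tau).
Proof.
move=> ye y1 yV [_ acc]; have e0 := enorm_ge0 (y - ybar).
apply: (le_trans (enorm_mulmx_ge _ yV)).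
have -> : V *m (y + d - ybar) = (V *m d + g y) - (g y - V *m (y - ybar)).
  by rewrite opprB addrACA subrr addr0 -mulmxDr addrA (addrC d).
apply: (le_trans (enormBl _ _)); rewrite mulrDl; apply: lerD.
  move: acc; rewrite /newton_accurate grad_f => /le_trans; apply.
  rewrite ge_min; apply/orP; right.
  rewrite -powRM ?(ltW L_gt0)//.
  rewrite ge0_ler_powR ?nnegrE ?enorm_ge0 ?mulr_ge0 ?(ltW L_gt0)//.
    by rewrite addr_ge0// ltW.
  by have := g_lip y ybar; rewrite gybar subr0.
apply: (le_trans (g_local ye yV)); rewrite ler_wpM2l//.
have [->|yn] := eqVneq (enorm (y - ybar)) 0; first by rewrite expr0n powR_ge0.
rewrite -powR_mulrn//; apply: ger_powR; first by rewrite lt0r yn e0 y1.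
by rewrite -[2%:R]/(1 + 1) lerD2l.
Qed.

Lemma powR_split (t : R) : 0 <= t -> t `^ (1 + tau) = t `^ tau * t.
Proof.
move=> t0; have [->|tn0] := eqVneq t 0.
  by rewrite mulr0 powR0// gt_eqF// addr_gt0.
by rewrite powRD ?tn0 ?implybT// powRr1// mulrC.
Qed.

Let C_ge0 : 0 <= C. Proof. by rewrite addr_ge0 ?powR_ge0. Qed.

Lemma rate_small (a : R) : 0 < a ->
  exists2 r, 0 < r & forall t, 0 <= t -> t < r -> C * t `^ tau <= a.
Proof.
move=> a0; have C1 : 0 < C + 1 by rewrite ltr_wpDl.
exists ((a / (C + 1)) `^ tau^-1) => [|t t0 tr]; first by rewrite powR_gt0 ?divr_gt0.
have : t `^ tau <= a / (C + 1).
  have -> : a / (C + 1) = ((a / (C + 1)) `^ tau^-1) `^ tau.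
    by rewrite -powRrM mulVf ?gt_eqF// powRr1// ltW// divr_gt0.
  by apply: ge0_ler_powR; rewrite ?nnegrE ?powR_ge0 ?(ltW tau_gt0)// ltW.
rewrite ler_pdivlMr// mulrC mulrDl mul1r.
by have := powR_ge0 t tau; lra.
Qed.

(** Up to higher-order terms f y - f ybar = <g y, e> / 2, f (y + d) = f ybar and
    <g y, d> = - <g y, e>; the Armijo inequality then reads
    0 <= (1 / 2 - mu) <g y, e>, where <g y, e> >= |e|^2. *)
Lemma unit_step_accepted : exists2 r, 0 < r & forall y V d,
  enorm (y - ybar) < r -> Vs y V -> newton_direction f eta tau y V d ->
  armijo f mu delta y d 0 /\
  enorm (y + d - ybar) <= C * enorm (y - ybar) `^ (1 + tau).
Proof.
pose a := (1 / 2 - mu) / (2 * L).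
have a0 : 0 < a by rewrite divr_gt0 ?mulr_gt0// subr_gt0.
have a1 : a <= 1.
  by rewrite ler_pdivrMr ?mulr_gt0//; move: mu_gt0 L_ge1; lra.
have La : L * a = (1 / 2 - mu) / 2 by rewrite /a; field; rewrite gt_eqF.
have [r r0 small] := rate_small a0.
have K1 : 0 < K + 1 by rewrite ltr_wpDl.
pose b := (1 / 2 - mu) / (2 * (K + 1)).
have b0 : 0 < b by rewrite divr_gt0 ?mulr_gt0// subr_gt0.
exists (Num.min (Num.min eps 1) (Num.min r b)).
  by rewrite !lt_min eps_gt0 ltr01 r0.
move=> y V d; rewrite !lt_min => /andP[/andP[ye y1] /andP[yr yb]] yV dir.
have e_le := newton_step_local ye (ltW y1) yV dir; split => //.
have fy := f_local ye.
move: (enorm_ge0 (y - ybar)) (enorm_ge0 (y + d - ybar)) => t0 t0'.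
move: (small _ t0 yr) (e_le); rewrite powR_split// mulrA.
set s := C * _ `^ tau => sa e_le'.
have s0 : 0 <= s by rewrite mulr_ge0 ?powR_ge0.
have Kt : K * enorm (y - ybar) <= (1 / 2 - mu) / 2.
  move: yb; rewrite /b ltr_pdivlMr ?mulr_gt0// => yb.
  by lra.
have := f_upper ybar (y + d); rewrite gybar dotp0l addr0 => fyd.
have ge : enorm (y - ybar) ^+ 2 <= dotp (g y) (y - ybar).
  have := f_lower y ybar; have := f_lower ybar y; rewrite gybar dotp0l.
  by rewrite -(opprB y ybar) dotpNr enormN; lra.
have gL : enorm (g y) <= L * enorm (y - ybar).
  by have := g_lip y ybar; rewrite gybar subr0.
have gd : dotp (g y) d = dotp (g y) (y + d - ybar) - dotp (g y) (y - ybar).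
  by rewrite -dotpBr opprB addrA subrK addrAC subrr add0r.
have ge' := normr_dotp (g y) (y + d - ybar).
rewrite /armijo grad_f expr0 scale1r mulr1 gd.
move: e_le' t0 t0' fy fyd ge gL ge' Kt.
set t := enorm (y - ybar); set t' := enorm (y + d - ybar).
set G := dotp (g y) (y - ybar); set G' := dotp _ (y + d - ybar).
rewrite !ler_norml => tt t0 t0' /andP[fy1 fy2] fyd Gt gt /andP[G1 G2] Kt.
have t2 : t' ^+ 2 <= s * t ^+ 2.
  apply: (le_trans (y := (s * t) ^+ 2)).
    by apply: lerXn2r; rewrite ?nnegrE// (mulr_ge0 s0 t0).
  rewrite exprMn ler_wpM2r ?sqr_ge0// expr2 ler_piMr//.
  exact: le_trans sa a1.
have g1 : enorm (g y) * t' <= L * s * t ^+ 2.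
  rewrite (_ : L * s * t ^+ 2 = (L * t) * (s * t)); last by ring.
  by rewrite ler_pM ?enorm_ge0.
have Ls : L * s <= (1 / 2 - mu) / 2 by rewrite -La ler_pM2l.
have h1 : L / 2 * t' ^+ 2 <= L / 2 * (s * t ^+ 2).
  by rewrite ler_wpM2l// ltW// divr_gt0.
have h2 : mu * (enorm (g y) * t') <= 1 / 2 * (L * s * t ^+ 2).
  by rewrite ler_pM// ?mulr_ge0 ?enorm_ge0// ltW.
have h3 : (L * s + K * t) * t ^+ 2 <= (1 / 2 - mu) * t ^+ 2.
  by rewrite ler_wpM2r ?sqr_ge0//; lra.
have h4 : (1 / 2 - mu) * t ^+ 2 <= (1 / 2 - mu) * G.
  by rewrite ler_pM2l// subr_gt0.
have h5 : - (mu * (enorm (g y) * t')) <= mu * G'.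
  by rewrite -mulrN ler_pM2l//; lra.
rewrite exprS in fy1 *.
by lra.
Qed.

Lemma ssn_step_local : exists2 r, 0 < r & forall y y',
  enorm (y - ybar) < r -> ssn_step f Vs mu eta tau delta y y' ->
  enorm (y' - ybar) <= C * enorm (y - ybar) `^ (1 + tau).
Proof.
have [r r0 unit_step] := unit_step_accepted; exists r => // y y' yr.
move=> [V [d [[|k] [yV dir [_ kmin] ->]]]].
  by rewrite expr0 scale1r; have [] := unit_step _ _ _ yr yV dir.
by have [a0 _] := unit_step _ _ _ yr yV dir; case: (kmin 0%N).
Qed.

Lemma ssn_rate y0 (y : nat -> 'cV[R]_m) : ssn_sequence f Vs mu eta tau delta y0 y ->
  [/\ y @ \oo --> ybar,
     (fun j => enorm (y j.+1 - ybar) : R^o) =o_\oo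
       (fun j => enorm (y j - ybar) : R^o) &
     (fun j => enorm (y j.+1 - ybar) : R^o) =O_\oo
       (fun j => enorm (y j - ybar) `^ (1 + tau) : R^o)].
Proof.
move=> ys; have yc := ssn_cvg ys.
have [r r0 loc] := ssn_step_local.
have ysmall (e : R) : 0 < e -> \forall j \near \oo, enorm (y j - ybar) < e.
  move=> e0; move/cvg_enormP/cvgr0_norm_lt: yc => /(_ e e0).
  by apply: filterS => j; rewrite ger0_norm ?enorm_ge0.
case: ys => _ ys; split=> //.
  apply/eqoP => e e0; have [r' r'0 small] := rate_small e0.
  near=> j; rewrite !(@ger0_norm R) ?enorm_ge0//.
  have t0 := enorm_ge0 (y j - ybar).
  rewrite (le_trans (loc _ _ _ (ys j)))//; first by near: j; exact: ysmall.
  rewrite powR_split// mulrA ler_wpM2r// small//.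
  by near: j; exact: ysmall.
apply/eqO_exP; exists (C + 1); first by rewrite ltr_wpDl.
near=> j; rewrite !(@ger0_norm R) ?enorm_ge0 ?powR_ge0//.
rewrite (le_trans (loc _ _ _ (ys j)))//; first by near: j; exact: ysmall.
by rewrite ler_wpM2r ?powR_ge0// lerDl.
Unshelve. all: by end_near. Qed.

End Convergence.
End NewtonGlobal.

(** * Proximal mappings of sublinear functions and the dual objective *)

Section SublinearProx.
Context {R : realType} {n : nat}.
Variables (p : 'cV[R]_n -> R) (F : 'cV[R]_n -> 'cV[R]_n).
Hypothesis F_le : forall u z, dotp (u - F u) z <= p z.
Hypothesis F_eq : forall u, p (F u) = dotp (u - F u) (F u).
Implicit Types u v z : 'cV[R]_n.

(** The hypotheses on F say that u - F u is a subgradient of p at F u, p being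
    sublinear. *)
Lemma prox_sublinear u : prox (EFin \o p) u = F u.
Proof.
have opt z : p (F u) + 2^-1 * enorm (F u - u) ^+ 2 + 2^-1 * enorm (z - F u) ^+ 2
   <= p z + 2^-1 * enorm (z - u) ^+ 2.
  have := F_le u z; rewrite F_eq !enorm_sq !dotpE.
  by rewrite (dotpC z u) (dotpC z (F u)) (dotpC (F u) u); lra.
rewrite /prox; set P := (X in get X).
have PF : P (F u).
  move=> z /=; rewrite -!EFinD lee_fin.
  by have := opt z; have := sqr_ge0 (enorm (z - F u)); lra.
have : P (get P) by apply: getPex; exists (F u).
move=> /(_ (F u)) /=; rewrite -!EFinD lee_fin => h.
apply/eqP; rewrite -subr_eq0; apply/eqP/enorm0_eq0/eqP.
rewrite -sqrf_eq0 eq_le sqr_ge0 andbT.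
by have := opt (get P); lra.
Qed.

(** In other words, u - F u is the point where <F u, .> is maximal on the set of
    all v - F v. *)
Lemma prox_monotone u v : dotp (F u) (v - F v) <= dotp (F u) (u - F u).
Proof. by rewrite !(dotpC (F u)) -F_eq; exact: F_le. Qed.

Lemma prox_firm u v :
  enorm (F u - F v) ^+ 2 <= dotp (F u - F v) (u - v).
Proof.
have := prox_monotone u v; have := prox_monotone v u.
by rewrite enorm_sq !dotpE; lra.
Qed.

Lemma prox_nonexpansive u v : enorm (F u - F v) <= enorm (u - v).
Proof.
have [->|F0] := eqVneq (F u - F v) 0; first by rewrite enorm0 enorm_ge0.
rewrite -(ler_pM2l (enorm_gt0 F0)) -expr2.
exact: le_trans (prox_firm u v) (dotp_le_enorm _ _).
Qed.

(** As |F u| is the distance from u to a convex set, half of its square is convex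
    with gradient F. *)
Lemma half_sqr_prox_ge u v :
  dotp (F u) (v - u) <= 2^-1 * enorm (F v) ^+ 2 - 2^-1 * enorm (F u) ^+ 2.
Proof.
have := prox_monotone u v; have := sqr_ge0 (enorm (F v - F u)).
by rewrite sqrB_enorm !enorm_sq !dotpE (dotpC (F v) (F u)); lra.
Qed.

(** The distance from v to that convex set is at most |v - (u - F u)|. *)
Lemma half_sqr_prox_le u v :
  2^-1 * enorm (F v) ^+ 2 - 2^-1 * enorm (F u) ^+ 2 <=
  dotp (F u) (v - u) + 2^-1 * enorm (v - u) ^+ 2.
Proof.
have := prox_monotone v u; have := sqr_ge0 (enorm (v - u - (F v - F u))).
rewrite sqrB_enorm !enorm_sq !dotpE (dotpC (F v) (F u)) (dotpC v u).
rewrite (dotpC v (F v)) (dotpC v (F u)) (dotpC u (F v)) (dotpC u (F u)).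
by lra.
Qed.

End SublinearProx.

(** The conjugate of a positively homogeneous function is an indicator
    function; being 0 or infinite, it contributes nothing to the objective. *)
Lemma fine_conjugate_homogeneous (R : realType) (n : nat) (p : 'cV[R]_n -> R) z :
  (forall t x, 0 <= t -> p (t *: x) = t * p x) ->
  fine (conjugate (EFin \o p) z) = 0.
Proof.
move=> pZ; have ub x : ((dotp z x - p x)%:E <= conjugate (EFin \o p) z)%E.
  by rewrite EFinB; apply: ereal_sup_ubound; exists x.
have := ge_ereal_sup (S := [set ((dotp z x)%:E - (EFin \o p) x)%E | x in setT]).
rewrite -/(conjugate (EFin \o p) z).
case E : (conjugate _ _) ub => [r| |] //= ub lub.
apply/eqP; rewrite eq_le; apply/andP; split; last first.
  have := ub (0 *: 0); rewrite pZ// scale0r dotp0r mul0r subr0 lee_fin //.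
rewrite -lee_fin; apply: lub => _ [x _ <-]; rewrite -EFinB lee_fin leNgt.
apply/negP => gap0; set e := dotp z x - _ in gap0.
have r0 : 0 <= r.
  by have := ub (0 *: 0); rewrite pZ// scale0r dotp0r mul0r subr0 lee_fin.
have t0 : 0 <= (r + 1) / e by exact: divr_ge0 (addr_ge0 r0 ler01) (ltW gap0).
have := ub (((r + 1) / e) *: x); rewrite (pZ _ _ t0) dotpZr -mulrBr -/e lee_fin.
by rewrite divfK ?gt_eqF//; lra.
Qed.

Section DualObjective.
Context {R : realType} {n m : nat}.
Variables (A : 'M[R]_(m, n)) (b : 'cV[R]_m) (sigma : R) (x0 : 'cV[R]_n).
Variables (p : 'cV[R]_n -> R) (F : 'cV[R]_n -> 'cV[R]_n).
Hypothesis F_le : forall u z, dotp (u - F u) z <= p z.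
Hypothesis F_eq : forall u, p (F u) = dotp (u - F u) (F u).
Hypothesis sigma_gt0 : 0 < sigma.
Variable c : R.
Hypothesis c_ge0 : 0 <= c.
Hypothesis A_le : forall x, enorm (A *m x) <= c * enorm x.
Hypothesis At_le : forall y, enorm (A^T *m y) <= c * enorm y.
Implicit Types y z : 'cV[R]_m.

Definition dual_pt y := x0 - A^T *m y.

Definition dual_obj y :=
  dotp b y + 2^-1 * enorm y ^+ 2 + sigma / 2 * enorm (F (dual_pt y)) ^+ 2.

Definition dual_grad y := b + y - sigma *: (A *m F (dual_pt y)).

Lemma dual_ptB y z : dual_pt y - dual_pt z = - (A^T *m (y - z)).
Proof. by rewrite /dual_pt opprB addrC addrA subrK mulmxBr opprB. Qed.

Lemma dotp_dual_grad y h :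
  dotp (dual_grad y) h = dotp (b + y) h - sigma * dotp (F (dual_pt y)) (A^T *m h).
Proof. by rewrite /dual_grad dotpBl dotpZl dotp_mulmx. Qed.

Lemma dual_obj_expand y z :
  dual_obj z - dual_obj y - dotp (dual_grad y) (z - y) =
  2^-1 * enorm (z - y) ^+ 2 +
  sigma * (2^-1 * enorm (F (dual_pt z)) ^+ 2 - 2^-1 * enorm (F (dual_pt y)) ^+ 2
           - dotp (F (dual_pt y)) (dual_pt z - dual_pt y)).
Proof.
rewrite dotp_dual_grad dual_ptB dotpNr /dual_obj sqrB_enorm !enorm_sq.
by rewrite !dotpE (dotpC z y) (dotpC b y); field.
Qed.

Lemma dual_obj_lower y z :
  dual_obj y + dotp (dual_grad y) (z - y) + 2^-1 * enorm (z - y) ^+ 2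
    <= dual_obj z.
Proof.
have := dual_obj_expand y z.
have := half_sqr_prox_ge F_le F_eq (dual_pt y) (dual_pt z).
rewrite -subr_ge0 => /(mulr_ge0 (ltW sigma_gt0)); lra.
Qed.

Lemma dual_obj_upper y z :
  dual_obj z <= dual_obj y + dotp (dual_grad y) (z - y) +
    (1 + sigma * c ^+ 2) / 2 * enorm (z - y) ^+ 2.
Proof.
have := dual_obj_expand y z.
have := half_sqr_prox_le F_le F_eq (dual_pt y) (dual_pt z).
rewrite -subr_ge0 => /(mulr_ge0 (ltW sigma_gt0)).
have : enorm (dual_pt z - dual_pt y) ^+ 2 <= c ^+ 2 * enorm (z - y) ^+ 2.
  rewrite -exprMn; apply: lerXn2r; rewrite ?nnegrE ?enorm_ge0//.
    by rewrite mulr_ge0 ?enorm_ge0.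
  by rewrite dual_ptB enormN.
rewrite -subr_ge0 => /(mulr_ge0 (ltW sigma_gt0)).
by lra.
Qed.

Lemma dual_grad_lip y z :
  enorm (dual_grad y - dual_grad z) <= (1 + sigma * c ^+ 2) * enorm (y - z).
Proof.
have -> : dual_grad y - dual_grad z =
   (y - z) - sigma *: (A *m (F (dual_pt y) - F (dual_pt z))).
  rewrite /dual_grad mulmxBr.
  move: (A *m F (dual_pt y)) (A *m F (dual_pt z)) => u v.
  by apply/colP => i; rewrite !mxE; ring.
rewrite (le_trans (enormBl _ _))// mulrDl mul1r lerD2l enormZ gtr0_norm//.
rewrite -mulrA ler_pM2l// (le_trans (A_le _))// expr2 -mulrA ler_wpM2l//.
apply: le_trans (prox_nonexpansive F_le F_eq _ _) _.
by rewrite dual_ptB enormN.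
Qed.

(** The error of the trapezoidal rule.  Quadratic terms are integrated exactly;
    what remains is an inner product of increments that compensate each other
    wherever F is smooth. *)
Lemma dual_trapezoid y z :
  dual_obj y - dual_obj z - 2^-1 * dotp (dual_grad y + dual_grad z) (y - z) =
  - (sigma / 2 * dotp (F (dual_pt y) + F (dual_pt z))
      (dual_pt y - F (dual_pt y) - (dual_pt z - F (dual_pt z)))).
Proof.
have -> : dual_pt y - F (dual_pt y) - (dual_pt z - F (dual_pt z)) =
    - (A^T *m (y - z)) - (F (dual_pt y) - F (dual_pt z)).
  by rewrite -dual_ptB; apply/colP => i; rewrite !mxE; ring.
rewrite dotpDl !dotp_dual_grad /dual_obj !enorm_sq !dotpE.
by rewrite (dotpC z y) (dotpC (F (dual_pt z)) (F (dual_pt y))); field.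
Qed.

End DualObjective.

(** * Jacobians and Clarke Jacobians *)

Lemma convex_hull_sub (R : realType) (E : lmodType R) (S C : set E) :
  (forall x y t, 0 <= t -> t <= 1 -> C x -> C y -> C (t *: x + (1 - t) *: y)) ->
  S `<=` C -> convex_hull S `<=` C.
Proof.
move=> cC SC x; apply=> // y z t; rewrite !inE => Cy Cz.
exact: cC.
Qed.

Lemma sub_convex_hull (R : realType) (E : lmodType R) (S : set E) :
  S `<=` convex_hull S.
Proof. by move=> x Sx C _; apply. Qed.

Section Differentiability.
Context {R : realType} {n m : nat}.
Variables (F : 'cV[R]_n -> 'cV[R]_m) (x : 'cV[R]_n).

Lemma Jac_quadratic (J : 'M[R]_(m, n)) (K eps : R) : 0 <= K -> 0 < eps ->
  (forall z, enorm (z - x) < eps ->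
    enorm (F z - F x - J *m (z - x)) <= K * enorm (z - x) ^+ 2) ->
  differentiable F x /\ Jac F x = J.
Proof.
move=> K0 eps0 FJ.
have [c c0 Jc] := enorm_mulmx_bounded J.
have Jcont : continuous (mulmx J : 'cV[R]_n -> 'cV[R]_m).
  move=> y; have FF : Filter (nbhs y) by exact: (@nbhs_filter 'cV[R]_n y).
  apply/cvg_enormP/cvgr0Pnorm_lt => e e0.
  have c1 : 0 < c + 1 by rewrite ltr_wpDl.
  have idc : idfun z @[z --> y] --> y by exact: cvg_id.
  move/cvg_enormP/cvgr0_norm_lt : idc => /(_ (e / (c + 1)) (divr_gt0 e0 c1)).
  apply: filterS => z /=; rewrite !ger0_norm ?enorm_ge0// ltr_pdivlMr// => h.
  rewrite -mulmxBr (le_lt_trans (Jc _))// (le_lt_trans _ h)// mulrC.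
  by rewrite ler_wpM2l ?enorm_ge0// lerDl.
have dF : F \o shift x = cst (F x) + (mulmx J : 'cV[R]_n -> 'cV[R]_m)
    +o_ (0 : 'cV[R]_n) id.
  apply/eqaddoP => e e0.
  have FF : Filter (nbhs (0 : 'cV[R]_n)) by exact: nbhs_filter.
  pose a := K * n%:R ^+ 2 + 1.
  have a0 : 0 < a by rewrite ltr_wpDl// mulr_ge0// sqr_ge0.
  have idc : idfun z @[z --> (0 : 'cV[R]_n)] --> (0 : 'cV[R]_n) by exact: cvg_id.
  move/cvgr0_norm_lt : (idc) => /(_ (e / a) (divr_gt0 e0 a0)).
  move/cvg_enormP/cvgr0_norm_lt : idc => /(_ eps eps0).
  apply: filterS2 => h /=; rewrite subr0 ger0_norm ?enorm_ge0// => he ha.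
  rewrite -![(_ + _ : _ -> _) _]/(_ + _) -![(- _ : _ -> _) _]/(- _) /=.
  rewrite opprD addrA /cst.
  rewrite (le_trans (norm_le_enorm _))//.
  have := FJ (h + x); rewrite addrK => /(_ he) /le_trans; apply.
  apply: (@le_trans _ _ (a * (`|h| * `|h|))); last first.
    rewrite mulrA ler_wpM2r// ltW// mulrC.
    by rewrite -ltr_pdivlMr.
  rewrite /a mulrDl mul1r -expr2 -mulrA -exprMn.
  rewrite ler_wpDr ?sqr_ge0// ler_wpM2l//.
  by apply: lerXn2r; rewrite ?nnegrE ?enorm_ge0 ?mulr_ge0// enorm_le_norm.
have dFE := diff_unique Jcont dF.
split; first by apply/diff_locallyP; rewrite dFE.
by apply/matrixP => i j; rewrite mxE dFE /= -colE mxE.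
Qed.

(** Limits of difference quotients along one direction determine the entries of
    the Jacobian, and rule out differentiability when they are not linear. *)
Lemma cvg_quotient v : differentiable F x ->
  (fun k => k.+1%:R *: (F (x + k.+1%:R^-1 *: v) - F x)) @ \oo --> 'd F x v.
Proof.
move=> dF; rewrite -deriveE//.
have dv : h^-1 *: ((F \o shift x) (h *: v) - F x) @[h --> 0^'] --> 'D_v F x.
  exact: (diff_derivable (v := v) dF).
have h0 : @harmonic R @ \oo --> (0 : R)^'.
  move=> P P0.
  have Pk : \forall k \near \oo, @harmonic R k != 0 -> P (harmonic k).
    exact: (@cvg_harmonic R _ P0).
  rewrite /= /nbhs /=; apply: filterS Pk => k; apply.
  by rewrite /harmonic /= invr_eq0 pnatr_eq0.
rewrite (_ : (fun k => _) =
  (fun h => h^-1 *: ((F \o shift x) (h *: v) - F x)) \o @harmonic R).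
  exact: cvg_comp h0 dv.
by apply/funext => k; rewrite /= /harmonic invrK (addrC x).
Qed.

End Differentiability.
Arguments cvg_quotient {R n m F x} v.

Section SequenceLimits.
Context {R : realType}.
Implicit Types (h : nat -> R) (l c : R).

Lemma cvg_eq_near h l c :
  h @ \oo --> l -> (\forall k \near \oo, h k = c) -> l = c.
Proof. by move=> hl hc; apply: (closed_cvg _ (@closed_eq R c) hc _ hl). Qed.

Lemma cvg_eq_near_mx n m (h : nat -> 'M[R]_(n, m)) (l c : 'M[R]_(n, m)) :
  h @ \oo --> l -> (\forall k \near \oo, h k = c) -> l = c.
Proof.
move=> hl hc; apply/matrixP => i j; have hij := cvg_coord i j hl.
have hcij : \forall k \near \oo, h k i j = c i j.
  by apply: filterS hc => k ->.
exact: (cvg_eq_near hij hcij).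
Qed.

Lemma cvg_ge_near h l c :
  h @ \oo --> l -> (\forall k \near \oo, c <= h k) -> c <= l.
Proof. by move=> hl hc; apply: (closed_cvg _ (@closed_ge R c) hc _ hl). Qed.

Lemma cvg_le_near h l c :
  h @ \oo --> l -> (\forall k \near \oo, h k <= c) -> l <= c.
Proof. by move=> hl hc; apply: (closed_cvg _ (@closed_le R c) hc _ hl). Qed.

Lemma cvg_near_lt h l c : h @ \oo --> l -> l < c -> \forall k \near \oo, h k < c.
Proof. by move=> hl lc; exact: (cvgr_lt l hl). Qed.

Lemma cvg_near_gt h l c : h @ \oo --> l -> c < l -> \forall k \near \oo, c < h k.
Proof. by move=> hl lc; exact: (cvgr_gt l hl). Qed.

End SequenceLimits.

(** * Projection onto a Euclidean ball *)

Section BallProjection.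
Context {R : realType} {k : nat}.
Implicit Types (v w z x : 'cV[R]_k) (lam : R).

Definition ballp lam v := if enorm v <= lam then v else (lam / enorm v) *: v.

(** The factor by which v minus its projection onto the ball shortens v. *)
Definition shrink lam v : R := if enorm v <= lam then 0 else 1 - lam / enorm v.

Definition radial_jac lam v : 'M[R]_k :=
  (lam / enorm v) *: (1%:M - (enorm v ^+ 2)^-1 *: (v *m v^T)).

Lemma subr_ballp lam v : v - ballp lam v = shrink lam v *: v.
Proof.
rewrite /ballp /shrink; case: ifP => _; first by rewrite subrr scale0r.
by rewrite scalerBl scale1r.
Qed.

Lemma shrink_ge0 lam v : 0 <= lam -> 0 <= shrink lam v.
Proof.
move=> l0; rewrite /shrink; case: (leP (enorm v) lam) => // vl.
by rewrite subr_ge0 ler_pdivrMr ?mul1r 1?ltW// (le_lt_trans l0).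
Qed.

Lemma enorm_ballp lam v : 0 <= lam -> enorm (ballp lam v) <= lam.
Proof.
move=> l0; rewrite /ballp; case: (leP (enorm v) lam) => // vl.
have v0 : 0 < enorm v by rewrite (le_lt_trans l0).
by rewrite enormZ ger0_norm ?divr_ge0 ?enorm_ge0// divfK ?gt_eqF.
Qed.

Lemma dotp_ballp_shrink lam v : 0 <= lam ->
  dotp (ballp lam v) (shrink lam v *: v) = lam * enorm (shrink lam v *: v).
Proof.
move=> l0; rewrite enormZ (ger0_norm (shrink_ge0 _ l0)) /ballp /shrink.
case: (leP (enorm v) lam) => vl; first by rewrite scale0r dotp0r mul0r mulr0.
have v0 : 0 < enorm v by rewrite (le_lt_trans l0).
by rewrite !dotpE -enorm_sq; field; rewrite gt_eqF.
Qed.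

Lemma proj_eball lam v : 0 <= lam -> proj (eball lam) v = ballp lam v.
Proof.
move=> l0; set q := ballp lam v.
have opt z : eball lam z ->
    enorm (q - v) ^+ 2 + enorm (z - q) ^+ 2 <= enorm (z - v) ^+ 2.
  rewrite /eball /= => zl.
  have key : dotp (v - q) z <= dotp (v - q) q.
    rewrite subr_ballp (dotpC _ q) dotp_ballp_shrink// mulrC.
    rewrite (le_trans (dotp_le_enorm _ _))// ler_wpM2l ?enorm_ge0//.
  have -> : z - v = (z - q) - (v - q) by rewrite opprB addrA subrK.
  by rewrite (enormB q v) (sqrB_enorm (z - q)) (dotpC (z - q)) (dotpBr z); lra.
rewrite /proj; set P := (X in get X).
have Pq : P q.
  split=> [|z zl]; first exact: enorm_ballp.
  rewrite -(@ler_pXn2r _ 2)// ?nnegrE ?enorm_ge0//.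
  by have := opt z zl; have := sqr_ge0 (enorm (z - q)); lra.
have [gl /(_ q Pq.1) gq] : P (get P) by apply: getPex; exists q.
apply/eqP; rewrite -subr_eq0; apply/eqP/enorm0_eq0/eqP.
rewrite -sqrf_eq0 eq_le sqr_ge0 andbT.
have : enorm (get P - v) ^+ 2 <= enorm (q - v) ^+ 2.
  by rewrite lerXn2r ?nnegrE ?enorm_ge0.
by have := opt _ gl; lra.
Qed.

Lemma ballp_outside lam v : lam <= enorm v -> ballp lam v = (lam / enorm v) *: v.
Proof.
rewrite /ballp => lv; case: ifP => // vl.
have E : enorm v = lam by apply/eqP; rewrite eq_le vl lv.
have [l0|l0] := eqVneq lam 0; last by rewrite E divff// scale1r.
by rewrite l0 mul0r scale0r; apply: enorm0_eq0; rewrite E.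
Qed.

Lemma shrink_outside lam v : lam <= enorm v -> 0 < lam ->
  shrink lam v = 1 - lam / enorm v.
Proof.
rewrite /shrink => lv l0; case: ifP => // vl.
have -> : enorm v = lam by apply/eqP; rewrite eq_le vl lv.
by rewrite divff ?gt_eqF// subrr.
Qed.

Lemma mulmx_outer v x : v *m v^T *m x = dotp v x *: v.
Proof.
rewrite -mulmxA; apply/colP => i; rewrite !mxE big_ord1 mxE mulrC.
congr (_ * _); apply: eq_bigr => j _; by rewrite mxE.
Qed.

Lemma radial_jac_mul lam v x :
  radial_jac lam v *m x =
  (lam / enorm v) *: (x - (dotp v x / enorm v ^+ 2) *: v).
Proof.
rewrite /radial_jac -scalemxAl mulmxBl mul1mx -scalemxAl mulmx_outer scalerA.
by rewrite [X in X *: v]mulrC.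
Qed.

(** In terms of norms and unit vectors, the identities for points outside the ball
    become rational identities between scalars. *)
Lemma unit_decomposition lam z w : 0 < lam -> lam <= enorm z -> lam <= enorm w ->
  exists p q g, let a := enorm z in let c := enorm w in
  [/\ z = a *: p, w = c *: q, dotp p p = 1, dotp q q = 1 &
      dotp p q = g /\ enorm (z - w) ^+ 2 = (a - c) ^+ 2 + 2 * a * c * (1 - g)].
Proof.
move=> l0 lz lw; have a0 := lt_le_trans l0 lz; have c0 := lt_le_trans l0 lw.
exists ((enorm z)^-1 *: z), ((enorm w)^-1 *: w).
exists (dotp ((enorm z)^-1 *: z) ((enorm w)^-1 *: w)); split.
- by rewrite scalerA divff ?gt_eqF// scale1r.
- by rewrite scalerA divff ?gt_eqF// scale1r.
- by rewrite !dotpE -enorm_sq; field; rewrite gt_eqF.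
- by rewrite !dotpE -enorm_sq; field; rewrite gt_eqF.
- by split=> //; rewrite sqrB_enorm !dotpE; field; rewrite !gt_eqF.
Qed.

(** Outside the ball the projection has a second-order expansion whose error is
    uniform, since the norms stay above the radius. *)
Lemma ballp_expansion lam z w : 0 < lam -> lam <= enorm z -> lam <= enorm w ->
  enorm (ballp lam z - ballp lam w - radial_jac lam z *m (z - w)) <=
  3 / 2 / lam * enorm (z - w) ^+ 2.
Proof.
move=> l0 lz lw; rewrite !ballp_outside// radial_jac_mul.
have [p [q [g]]] := unit_decomposition l0 lz lw.
set a := enorm z; set c := enorm w; set D := enorm (z - w).
rewrite /= => -[zE wE pp qq [pq DE]].
have a0 : 0 < a by exact: lt_le_trans lz. have c0 : 0 < c by exact: lt_le_trans lw.
have -> : (lam / a) *: z - (lam / c) *: w -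
    (lam / a) *: (z - w - (dotp z (z - w) / a ^+ 2) *: z) =
  (lam * (1 - c / a)) *: (p - q) + (lam * (c / a) * (1 - g)) *: p.
  have -> : dotp z (z - w) = a ^+ 2 - a * c * g.
    by rewrite [in LHS]zE [in LHS]wE !dotpE pp pq; ring.
  rewrite [in LHS]zE [in LHS]wE; apply/colP => i; rewrite !mxE; field.
  by rewrite !gt_eqF.
have D0 : 0 <= D by exact: enorm_ge0.
have p1 : enorm p = 1 by rewrite /enorm pp sqrtr1.
have q1 : enorm q = 1 by rewrite /enorm qq sqrtr1.
have g1 : 0 <= 1 - g.
  by have := dotp_le_enorm p q; rewrite p1 q1 pq; lra.
have ac0 : 0 < a * c by rewrite mulr_gt0.
have acl : lam ^+ 2 <= a * c by rewrite expr2 ler_pM// ltW.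
have gD : 2 * (1 - g) * (a * c) <= D ^+ 2.
  by rewrite DE; have := sqr_ge0 (a - c); lra.
have pqD : enorm (p - q) <= D / lam.
  rewrite ler_pdivlMr// -(@ler_pXn2r _ 2)// ?nnegrE ?mulr_ge0 ?enorm_ge0 ?(ltW l0)//.
  rewrite exprMn sqrB_enorm p1 q1 pq (le_trans _ gD)//.
  rewrite (_ : 1 ^+ 2 - 2 * g + 1 ^+ 2 = 2 * (1 - g)); last by ring.
  by rewrite ler_wpM2l// mulr_ge0.
have caD : `|1 - c / a| <= D / lam.
  rewrite (_ : 1 - c / a = (a - c) / a); last by field; rewrite gt_eqF.
  rewrite normrM normfV (gtr0_norm a0) ler_pdivrMr// mulrAC ler_pdivlMr//.
  rewrite (le_trans (y := D * lam))//; last by rewrite ler_wpM2l.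
  by rewrite ler_wpM2r ?(ltW l0)// enorm_dist.
rewrite (le_trans (enormD _ _))// !enormZ p1 mulr1.
have h1 : `|lam * (1 - c / a)| * enorm (p - q) <= D ^+ 2 / lam.
  rewrite normrM (gtr0_norm l0) -mulrA.
  apply: (le_trans (y := lam * ((D / lam) * (D / lam)))).
    by rewrite ler_pM2l// ler_pM ?enorm_ge0.
  by rewrite le_eqVlt; apply/orP; left; apply/eqP; field; rewrite gt_eqF.
have h2 : `|lam * (c / a) * (1 - g)| <= D ^+ 2 / lam / 2.
  rewrite ger0_norm; last first.
    exact: mulr_ge0 (mulr_ge0 (ltW l0) (divr_ge0 (ltW c0) (ltW a0))) g1.
  rewrite -(ler_pM2r (exprn_gt0 2 a0)).
  rewrite (_ : _ * a ^+ 2 = lam / 2 * (2 * (1 - g) * (a * c))); last first.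
    by field; rewrite gt_eqF.
  apply: (le_trans (y := lam / 2 * D ^+ 2)); first by rewrite ler_pM2l ?divr_gt0.
  rewrite (_ : lam / 2 * D ^+ 2 = D ^+ 2 / lam / 2 * lam ^+ 2); last first.
    by field; rewrite gt_eqF.
  apply: ler_wpM2l; last by rewrite lerXn2r ?nnegrE// ltW.
  by rewrite !divr_ge0 ?sqr_ge0// ltW.
rewrite (le_trans (lerD h1 h2))// le_eqVlt; apply/orP; left; apply/eqP; field.
by rewrite gt_eqF.
Qed.

(** With p and q the directions of z and w, the inner product equals
    lam (|z| - |w|) (1 - <p, q>), a product of a first-order and a second-order
    term. *)
Lemma ballp_trapezoid lam z w : 0 < lam -> lam <= enorm z -> lam <= enorm w ->
  `|dotp (shrink lam z *: z + shrink lam w *: w) (ballp lam z - ballp lam w)| <=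
  2^-1 / lam * enorm (z - w) ^+ 3.
Proof.
move=> l0 lz lw; rewrite !ballp_outside// !shrink_outside//.
have [p [q [g]]] := unit_decomposition l0 lz lw.
set a := enorm z; set c := enorm w; set D := enorm (z - w).
rewrite /= => -[zE wE pp qq [pq DE]].
have a0 : 0 < a by exact: lt_le_trans lz. have c0 : 0 < c by exact: lt_le_trans lw.
have -> : dotp ((1 - lam / a) *: z + (1 - lam / c) *: w)
   ((lam / a) *: z - (lam / c) *: w) = lam * (a - c) * (1 - g).
  rewrite [in LHS]zE [in LHS]wE !dotpE (dotpC q p) pp qq pq; field.
  by rewrite !gt_eqF.
have D0 : 0 <= D by exact: enorm_ge0.
have p1 : enorm p = 1 by rewrite /enorm pp sqrtr1.
have q1 : enorm q = 1 by rewrite /enorm qq sqrtr1.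
have g1 : 0 <= 1 - g.
  by have := dotp_le_enorm p q; rewrite p1 q1 pq; lra.
have acl : lam ^+ 2 <= a * c by rewrite expr2 ler_pM// ltW.
have gD : lam ^+ 2 * (2 * (1 - g)) <= D ^+ 2.
  rewrite (le_trans (y := a * c * (2 * (1 - g))))//.
    by rewrite ler_wpM2r// mulr_ge0.
  by rewrite DE; have := sqr_ge0 (a - c); lra.
rewrite !normrM (gtr0_norm l0) (ger0_norm g1).
rewrite -(ler_pM2l l0).
apply: (le_trans (y := 2^-1 * (`|a - c| * (lam ^+ 2 * (2 * (1 - g)))))).
  by rewrite le_eqVlt; apply/orP; left; apply/eqP; field.
apply: (le_trans (y := 2^-1 * (D * D ^+ 2))).
  rewrite ler_pM2l ?invr_gt0// ler_pM ?enorm_dist// !mulr_ge0 ?(ltW l0)//.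
rewrite le_eqVlt; apply/orP; left; apply/eqP; field.
by rewrite gt_eqF.
Qed.

Lemma radial_jac0 v : radial_jac 0 v = 0.
Proof. by rewrite /radial_jac mul0r scale0r. Qed.

Lemma ballp0 v : ballp 0 v = 0.
Proof. by rewrite ballp_outside ?enorm_ge0// mul0r scale0r. Qed.

Lemma ballp_Jac_inside lam v : enorm v < lam ->
  differentiable (ballp lam) v /\ Jac (ballp lam) v = 1%:M.
Proof.
move=> vl; apply: (@Jac_quadratic _ _ _ _ _ _ 0 (lam - enorm v)) => //.
  by rewrite subr_gt0.
move=> z zv; have zl : enorm z < lam.
  by have := enormD (z - v) v; rewrite subrK; lra.
by rewrite /ballp (ltW zl) (ltW vl) mul1mx subrr enorm0 mul0r.
Qed.

Lemma ballp_Jac_outside lam v : 0 < lam -> lam < enorm v ->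
  differentiable (ballp lam) v /\ Jac (ballp lam) v = radial_jac lam v.
Proof.
move=> l0 lv; apply: (@Jac_quadratic _ _ _ _ _ _ (3 / 2 / lam) (enorm v - lam)).
- by rewrite !divr_ge0// ltW.
- by rewrite subr_gt0.
move=> z zv; have zl : lam <= enorm z.
  by have := enormD (v - z) z; rewrite subrK enormB; lra.
have -> : ballp lam z - ballp lam v - radial_jac lam v *m (z - v) =
    - (ballp lam v - ballp lam z - radial_jac lam v *m (v - z)).
  rewrite !mulmxBr; move: (_ *m z) (_ *m v) => a b.
  by apply/colP => i; rewrite !mxE; ring.
by rewrite enormN (enormB z v); exact: ballp_expansion (ltW lv) zl.
Qed.

Lemma ballp_Jac0 v : differentiable (ballp 0) v /\ Jac (ballp 0) v = radial_jac 0 v.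
Proof.
apply: (@Jac_quadratic _ _ _ _ _ _ 0 1) => // z _.
by rewrite !ballp0 radial_jac0 mul0mx !subrr enorm0 mul0r.
Qed.

(** Along v the one-sided derivatives are 0 outwards and v inwards. *)
Lemma ballp_not_differentiable lam v : 0 < lam -> enorm v = lam ->
  ~ differentiable (ballp lam) v.
Proof.
move=> l0 vl df.
have h0 j : 0 < (j.+1%:R : R)^-1 by rewrite invr_gt0.
have h1 j : (j.+1%:R : R)^-1 <= 1 by rewrite invf_le1 ?ler1n.
have d0 : 'd (ballp lam) v v = 0.
  suff H : \forall j \near \oo, j.+1%:R *:
      (ballp lam (v + j.+1%:R^-1 *: v) - ballp lam v) = 0.
    exact: (cvg_eq_near_mx (cvg_quotient v df) H).
  apply: nearW => j.
  have -> : v + j.+1%:R^-1 *: v = (1 + j.+1%:R^-1) *: v by rewrite scalerDl scale1r.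
  have E : enorm ((1 + j.+1%:R^-1) *: v) = (1 + j.+1%:R^-1) * lam.
    by rewrite enormZ vl ger0_norm// addr_ge0// ltW.
  have hj := h0 j.
  rewrite [ballp lam v]ballp_outside ?vl// ballp_outside E; last first.
    by rewrite ler_peMl ?(ltW l0)// lerDl ltW.
  rewrite scalerA (_ : _ * _ = lam / lam) ?subrr ?scaler0//.
  by field; rewrite !gt_eqF// addr_gt0.
have d1 : 'd (ballp lam) v (- v) = - v.
  suff H : \forall j \near \oo, j.+1%:R *:
      (ballp lam (v + j.+1%:R^-1 *: - v) - ballp lam v) = - v.
    exact: (cvg_eq_near_mx (cvg_quotient (- v) df) H).
  apply: nearW => j.
  have -> : v + j.+1%:R^-1 *: - v = (1 - j.+1%:R^-1) *: v.
    by rewrite scalerBl scale1r scalerN.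
  have E : enorm ((1 - j.+1%:R^-1) *: v) = (1 - j.+1%:R^-1) * lam.
    by rewrite enormZ vl ger0_norm// subr_ge0.
  rewrite /ballp E vl lexx ger_pMl// gerBl (ltW (h0 j)).
  by rewrite scalerBl scale1r addrAC subrr add0r scalerN scalerA divff ?scale1r//.
move: d1; rewrite linearN d0 oppr0 => /eqP; rewrite eq_sym oppr_eq0 => /eqP v0.
by move: vl l0; rewrite v0 enorm0 => <-; rewrite ltxx.
Qed.

Lemma ballp_Jac_cases lam v : 0 <= lam -> differentiable (ballp lam) v ->
  [/\ 0 < lam, enorm v < lam & Jac (ballp lam) v = 1%:M] \/
  ((lam = 0 \/ lam < enorm v) /\ Jac (ballp lam) v = radial_jac lam v).
Proof.
rewrite le_eqVlt => /predU1P[<- _|l0 df].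
  by right; split; [left|exact: (ballp_Jac0 v).2].
case: (ltgtP (enorm v) lam) => [vl|vl|vl].
- by left; split=> //; exact: (ballp_Jac_inside vl).2.
- by right; split; [right|exact: (ballp_Jac_outside l0 vl).2].
- by have := ballp_not_differentiable l0 vl.
Qed.

Lemma radial_jac_cvg lam (u : nat -> 'cV[R]_k) v i j : v != 0 -> u @ \oo --> v ->
  (fun q => radial_jac lam (u q) i j) @ \oo --> radial_jac lam v i j.
Proof.
move=> v0 uv; have nv0 : enorm v != 0 by rewrite gt_eqF// enorm_gt0.
have radE w : radial_jac lam w i j =
    lam * (enorm w)^-1 * ((i == j)%:R - (enorm w ^+ 2)^-1 * (w i 0 * w j 0)).
  by rewrite /radial_jac !mxE big_ord1 mxE.
under eq_fun do rewrite radE; rewrite radE.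
have nu := cvg_enorm uv.
apply: cvgM; first by apply: cvgM; [exact: cvg_cst|exact: cvgV].
apply: cvgB; first exact: cvg_cst.
apply: cvgM; last by apply: cvgM; exact: cvg_coord.
apply: cvgV; first by rewrite sqrf_eq0.
by apply: cvgM.
Qed.
Arguments radial_jac_cvg lam {u v} i j.

(** The matrices of the Clarke Jacobian of the projection: the identity inside
    the ball, the radial matrix outside, a segment on the sphere. *)
Definition ball_jac lam v (S : 'M[R]_k) := exists s : R,
  [/\ 0 <= s <= 1, S = (1 - s) *: 1%:M + s *: radial_jac lam v,
      0 < s -> lam <= enorm v & s < 1 -> 0 < lam /\ enorm v <= lam].

(** A limit of Jacobians other than the identity is a limit of radial matrices
    taken at points outside the ball. *)
Lemma clarke_ballp lam v : 0 <= lam ->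
  clarke_Jac (proj (eball lam)) v `<=` ball_jac lam v.
Proof.
move=> l0; have -> : proj (eball lam) = ballp lam.
  by apply/funext => z; exact: proj_eball.
apply: convex_hull_sub => [S1 S2 t t0 t1|J].
  move=> [s1 [/andP[s10 s11] -> p1 q1]] [s2 [/andP[s20 s21] -> p2 q2]].
  exists (t * s1 + (1 - t) * s2); split.
  - apply/andP; split; nra.
  - by apply/matrixP => i j; rewrite !mxE; ring.
  - move=> h; have [/p1//|s1e] := ltP 0 s1; apply: p2.
    rewrite lt_neqAle s20 andbT; apply: contraTN h => /eqP <-.
    by rewrite mulr0 addr0 -leNgt mulr_ge0_le0.
  - move=> h; have [/q1//|s1e] := ltP s1 1; apply: q2.
    rewrite lt_neqAle s21 andbT; apply: contraTN h => /eqP ->.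
    by rewrite -leNgt; nra.
move=> [u [du uv Ju]].
have nu := cvg_enorm uv.
have radial : (\forall j \near \oo, (lam = 0 \/ lam < enorm (u j)) /\
    Jac (ballp lam) (u j) = radial_jac lam (u j)) -> ball_jac lam v J.
  move=> near_r; exists 1; rewrite ler01 lexx subrr scale0r scale1r add0r ltxx.
  have lv : lam <= enorm v.
    apply: (cvg_ge_near nu); apply: filterS near_r => j [[->|/ltW//] _].
    exact: enorm_ge0.
  split=> //; have [l00|ln0] := eqVneq lam 0.
    apply: (cvg_eq_near_mx Ju); apply: filterS near_r => j [_ ->].
    by rewrite l00 !radial_jac0.
  have v0 : v != 0.
    by apply: contraNneq ln0 => v0; move: lv; rewrite v0 enorm0 eq_le l0 andbT.
  apply/matrixP => i j; apply: (cvg_unique (@Rhausdorff R) (cvg_coord i j Ju)).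
  have E : \forall q \near \oo,
      radial_jac lam (u q) i j = Jac (ballp lam) (u q) i j.
    by apply: filterS near_r => q [_ ->].
  exact: cvg_trans (near_eq_cvg E) (radial_jac_cvg lam i j v0 uv).
have [Jv|nJv] := pselect (J = 1%:M /\ 0 < lam /\ enorm v <= lam).
  exists 0; case: Jv => -> [lp vl].
  by rewrite ler01 lexx subr0 scale1r scale0r addr0 ltxx; split.
apply: radial.
have cases j := ballp_Jac_cases l0 (du j).
have [vl|lv] := leP (enorm v) lam; last first.
  apply: filterS (cvg_near_gt nu lv) => j lj.
  by case: (cases j) => // -[_ /lt_trans/(_ lj)]; rewrite ltxx.
have [l00|ln0] := eqVneq lam 0.
  by apply: nearW => j; case: (cases j) => // -[]; rewrite l00 ltxx.
have J1 : J <> 1%:M.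
  by move=> J1; apply: nJv; rewrite lt0r ln0.
have /existsNP[i /existsNP[j Jij]] : ~ forall i j, J i j = (1%:M : 'M[R]_k) i j.
  by move=> E; apply: J1; apply/matrixP.
have e0 : 0 < `|J i j - (1%:M : 'M[R]_k) i j|.
  by rewrite normr_gt0 subr_eq0; apply/eqP.
have /cvgrPdist_lt/(_ _ e0) := cvg_coord i j Ju.
apply: filterS => q; case: (cases q) => // -[_ _ ->].
by rewrite ltxx.
Qed.

(** On the sphere, the centre of the ball gives a segment of inner points. *)
Lemma clarke_ballp_neq0 lam v : 0 <= lam ->
  clarke_Jac (proj (eball lam)) v !=set0.
Proof.
move=> l0; have -> : proj (eball lam) = ballp lam.
  by apply/funext => z; exact: proj_eball.
have const : differentiable (ballp lam) v ->
    clarke_Jac (ballp lam) v !=set0.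
  move=> df; exists (Jac (ballp lam) v); apply: sub_convex_hull.
  by exists (fun=> v); split=> //; exact: cvg_cst.
have [l00|ln0] := eqVneq lam 0.
  by apply: const; rewrite l00; exact: (ballp_Jac0 v).1.
have lp : 0 < lam by rewrite lt0r ln0.
case: (ltgtP (enorm v) lam) => vl.
- exact/const/(ballp_Jac_inside vl).1.
- exact/const/(ballp_Jac_outside lp vl).1.
pose u j : 'cV[R]_k := (1 - j.+1%:R^-1) *: v.
have uin j : enorm (u j) < lam.
  rewrite /u enormZ vl ger0_norm ?subr_ge0 ?invf_le1 ?ler1n//.
  by rewrite gtr_pMl// gtrBl invr_gt0.
exists 1%:M; apply: sub_convex_hull; exists u; split.
- by move=> j; exact: (ballp_Jac_inside (uin j)).1.
- apply/cvg_enormP.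
  have -> : (fun j => enorm (u j - v)) = @harmonic R \* cst (enorm v).
    apply/funext => j; rewrite /u scalerBl scale1r addrAC subrr add0r enormN.
    by rewrite enormZ ger0_norm// invr_ge0.
  by rewrite -(mul0r (enorm v)); exact: (cvgM cvg_harmonic (cvg_cst _)).
- have -> : (fun j => Jac (ballp lam) (u j)) = fun=> 1%:M.
    by apply/funext => j; exact: (ballp_Jac_inside (uin j)).2.
  exact: cvg_cst.
Qed.

Lemma ball_jac_form lam v S : 0 <= lam -> ball_jac lam v S ->
  exists al be, [/\ 0 <= al, 0 <= be, al + be * enorm v ^+ 2 <= 1 &
    forall x, x - S *m x = al *: x + (be * dotp v x) *: v].
Proof.
move=> l0 [s [/andP[s0 s1] -> sl _]].
exists (s * (1 - lam / enorm v)), (s * (lam / enorm v) / enorm v ^+ 2); split.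
- have [s00|sp] := leP s 0.
    by rewrite (_ : s = 0) ?mul0r//; apply/eqP; rewrite eq_le s00.
  rewrite mulr_ge0// subr_ge0; have [->|v0] := eqVneq (enorm v) 0.
    by rewrite invr0 mulr0.
  by rewrite ler_pdivrMr ?mul1r ?sl// lt0r v0 enorm_ge0.
- by rewrite !mulr_ge0 ?invr_ge0 ?exprn_ge0 ?enorm_ge0.
- have [->|v0] := eqVneq (enorm v) 0.
    by rewrite expr0n /= mulr0 addr0 invr0 mulr0 subr0 mulr1.
  by rewrite divfK ?sqrf_eq0// -mulrDr subrK mulr1.
- move=> x; rewrite mulmxDl -scalemxAl -scalemxAl mul1mx radial_jac_mul.
  by apply/colP => i; rewrite !mxE; ring.
Qed.

(** Close to w, a point lies on the same side of the sphere as w, unless w is on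
    the sphere; in that case both the inner and the outer formula hold at w. *)
Lemma ballp_local lam w : 0 <= lam -> exists K eps, [/\ 0 <= K, 0 < eps &
  forall z, enorm (z - w) < eps ->
  (forall S, ball_jac lam z S ->
    enorm (shrink lam z *: z - shrink lam w *: w - ((z - w) - S *m (z - w))) <=
      K * enorm (z - w) ^+ 2) /\
  `|dotp (shrink lam z *: z + shrink lam w *: w) (ballp lam z - ballp lam w)|
    <= K * enorm (z - w) ^+ 3].
Proof.
move=> l0; exists (3 / 2 / lam).
have toball z (S : 'M[R]_k) :
    shrink lam z *: z - shrink lam w *: w - ((z - w) - S *m (z - w)) =
    - (ballp lam z - ballp lam w - S *m (z - w)).
  rewrite -!subr_ballp.
  by move: (S *m _) => y; apply/colP => i; rewrite !mxE; ring.
have [l00|ln0] := eqVneq lam 0.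
  move: toball; rewrite l00 => toball; exists 1; rewrite invr0 mulr0.
  split=> // z _; rewrite !mul0r; split; last first.
    by rewrite !ballp0 subrr dotp0r normr0.
  move=> S [s [/andP[s0 s1] -> _ sl]].
  have -> : s = 1.
    by apply/eqP; rewrite eq_le s1 leNgt; apply/negP => /sl[]; rewrite ltxx.
  rewrite toball !ballp0 !subrr scale0r scale1r !add0r radial_jac0 mul0mx.
  by rewrite !oppr0 enorm0.
have lp : 0 < lam by rewrite lt0r ln0.
have K0 : 0 <= 3 / 2 / lam by rewrite !divr_ge0.
exists (if enorm w == lam then 1 else `|enorm w - lam|); split=> //.
  by case: eqVneq => // wl; rewrite normr_gt0 subr_eq0.
move=> z zw.
have zout : lam <= enorm z -> lam <= enorm w.
  case: eqVneq zw => [->//|wl zw lz]; rewrite leNgt; apply/negP => wlt.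
  have := enorm_dist z w; move: zw.
  by rewrite ler_norml ltr0_norm ?subr_lt0// => ? /andP[]; lra.
have zin : enorm z <= lam -> enorm w <= lam.
  case: eqVneq zw => [->//|wl zw lz]; rewrite leNgt; apply/negP => wlt.
  have := enorm_dist z w; move: zw.
  by rewrite ler_norml gtr0_norm ?subr_gt0// => ? /andP[]; lra.
split.
  move=> S [s [/andP[s0 s1] -> sl s1l]]; rewrite toball enormN.
  have -> : ballp lam z - ballp lam w -
      ((1 - s) *: 1%:M + s *: radial_jac lam z) *m (z - w) =
    (1 - s) *: (ballp lam z - ballp lam w - (z - w)) +
    s *: (ballp lam z - ballp lam w - radial_jac lam z *m (z - w)).
    rewrite mulmxDl -scalemxAl -scalemxAl mul1mx.
    by move: (radial_jac _ _ *m _) => y; apply/colP => i; rewrite !mxE; ring.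
  rewrite (_ : (1 - s) *: _ = 0) ?add0r.
    rewrite enormZ ger0_norm//.
    have [s00|sp] := leP s 0.
      rewrite (_ : s = 0) ?mul0r ?(mulr_ge0 K0 (sqr_ge0 _))//.
      by apply/eqP; rewrite eq_le s00.
    have lz := sl sp.
    by rewrite (le_trans _ (ballp_expansion lp lz (zout lz)))// ler_piMl ?enorm_ge0.
  have [/s1l[_ zl]|s1e] := ltP s 1.
    by rewrite /ballp zl (zin zl) subrr scaler0.
  by rewrite (_ : s = 1) ?subrr ?scale0r//; apply/eqP; rewrite eq_le s1.
have [zl|lz] := leP (enorm z) lam.
  rewrite /shrink zl (zin zl) !scale0r addr0 dotp0l normr0.
  by rewrite mulr_ge0// exprn_ge0// enorm_ge0.
have lw := zout (ltW lz).
rewrite (le_trans (ballp_trapezoid lp (ltW lz) lw))//.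
rewrite ler_wpM2r ?exprn_ge0 ?enorm_ge0// ler_wpM2r ?invr_ge0//.
by rewrite -[leLHS]mul1r ler_wpM2r// ler1n.
Qed.

End BallProjection.

(** * Soft-thresholding *)

Section SoftThreshold.
Context {R : realType}.
Variable lam : R.
Hypothesis lam_ge0 : 0 <= lam.
Implicit Types t s h : R.

Definition clip t : R := if t < - lam then - lam else if lam < t then lam else t.

Lemma clipP t : [\/ t < - lam /\ clip t = - lam, lam < t /\ clip t = lam |
  (- lam <= t <= lam) /\ clip t = t].
Proof.
rewrite /clip; case: ltP => h1; first by constructor 1.
by case: ltP => h2; [constructor 2|constructor 3; rewrite ?h1 ?h2].
Qed.

Lemma clip_le t s : clip t * s <= lam * `|s|.
Proof.
have c : `|clip t| <= lam.
  by rewrite ler_norml; case: (clipP t) => -[h ->]; move: h lam_ge0; lra.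
rewrite (le_trans (ler_norm _))// normrM ler_wpM2r//.
Qed.

(** The factor s allows for the shrinking of a whole group. *)
Lemma clip_eq t s : 0 <= s ->
  clip t * (s * (t - clip t)) = lam * `|s * (t - clip t)|.
Proof.
move=> s0; rewrite normrM (ger0_norm s0).
case: (clipP t) => -[h ->].
- by rewrite ltr0_norm ?opprK; [ring|move: h; lra].
- by rewrite gtr0_norm; [ring|move: h; lra].
- by rewrite subrr normr0 !mulr0.
Qed.

(** The generalized slopes of the soft-thresholding function at t. *)
Definition slope t (th : R) :=
  [/\ 0 <= th <= 1, (lam < `|t| \/ lam = 0 -> th = 1) & (`|t| < lam -> th = 0)].

Lemma clip_lip t h : 0 <= h -> 0 <= (t + h - clip (t + h)) - (t - clip t) <= h.
Proof.
move=> h0; move: lam_ge0.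
by case: (clipP t) => -[p ->]; case: (clipP (t + h)) => -[q ->]; move: p q; lra.
Qed.

Lemma slope_vanish t th : slope t th -> (t - clip t) * th = t - clip t.
Proof.
move=> [_ t1 _]; case: (clipP t) => -[h ->].
- by rewrite t1 ?mulr1//; left; rewrite ltr0_norm; move: h lam_ge0; lra.
- by rewrite t1 ?mulr1//; left; rewrite gtr0_norm; move: h lam_ge0; lra.
- by rewrite subrr mul0r.
Qed.

(** Near a fixed s the soft-thresholding function is affine on each side of s,
    hence exactly reproduced by its slopes; the clipped part is locked as soon
    as one of the two values is nonzero. *)
Lemma soft_local s : exists2 eps, 0 < eps & forall t, `|t - s| < eps ->
  [/\ forall th, slope t th -> th * (t - s) = (t - clip t) - (s - clip s),
      (t - clip t) * (clip t - clip s) = 0 &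
      (s - clip s) * (clip t - clip s) = 0].
Proof.
have [l0|ln0] := eqVneq lam 0.
  exists 1 => // t _.
  have c0 x : clip x = 0.
    by case: (clipP x) => -[h ->]; move: h; rewrite l0; lra.
  rewrite !c0 !subr0 !mulr0; split=> // th [_ th1 _].
  by rewrite th1 ?mul1r//; right.
have lp : 0 < lam by rewrite lt0r ln0.
exists (if `|s| == lam then lam else `| `|s| - lam|).
  by case: eqVneq => // sl; rewrite normr_gt0 subr_eq0.
move=> t ts.
have : [\/ [/\ s = lam, 0 < t & t < lam + lam],
   [/\ s = - lam, t < 0 & - (lam + lam) < t], lam < s /\ lam < t |
   (s < - lam /\ t < - lam) \/ - lam < s < lam /\ - lam < t < lam].
  move: ts; case: eqVneq => [sl|sl].
    rewrite ltr_norml; have [s0|s0] := leP 0 s.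
      move: sl; rewrite ger0_norm// => -> /andP[]; constructor 1; split=> //; lra.
    move: sl; rewrite ltr0_norm// => sl /andP[? ?].
    by constructor 2; split; lra.
  have [s1|s1] := ltP lam `|s|.
    rewrite [X in _ < X]gtr0_norm ?subr_gt0// ltr_norml; move: s1.
    case: (leP 0 s) => s0; [rewrite ger0_norm // | rewrite ltr0_norm //].
      by move=> ? /andP[? ?]; constructor 3; split; lra.
    by move=> ? /andP[? ?]; constructor 4; left; split; lra.
  have sl1 : `|s| < lam by rewrite lt_neqAle sl.
  rewrite [X in _ < X]ltr0_norm ?subr_lt0//; move: sl1.
  rewrite !ltr_norml opprB.
  case: (leP 0 s) => s0; [rewrite ger0_norm // | rewrite ltr0_norm //].
    by move=> /andP[? ?] /andP[? ?]; constructor 4; right; split;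
      apply/andP; split; lra.
  by move=> /andP[? ?] /andP[? ?]; constructor 4; right; split;
      apply/andP; split; lra.
have cin x : - lam <= x -> x <= lam -> clip x = x.
  by move=> h1 h2; case: (clipP x) => -[h3 ->] //; move: h1 h2 h3; lra.
have cup x : lam <= x -> clip x = lam.
  by move=> h1; case: (clipP x) => -[h3 ->] //; move: h1 h3 lp; lra.
have cdn x : x <= - lam -> clip x = - lam.
  by move=> h1; case: (clipP x) => -[h3 ->] //; move: h1 h3 lp; lra.
have sup x th : lam < x -> slope x th -> th = 1.
  by move=> h1 [_ + _]; apply; left; rewrite gtr0_norm //; move: h1 lp; lra.
have sdn x th : x < - lam -> slope x th -> th = 1.
  by move=> h1 [_ + _]; apply; left; rewrite ltr0_norm //; move: h1 lp; lra.
have sin x th : - lam < x -> x < lam -> slope x th -> th = 0.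
  by move=> h1 h2 [_ _]; apply; rewrite ltr_norml h1.
case=> [[-> t0 t1]|[-> t0 t1]|[s0 t0]|[[s0 t0]|[/andP[s0 s1] /andP[t0 t1]]]].
- rewrite (cup lam)// subrr mul0r; have [tl|tl|->] := ltgtP t lam.
  + rewrite (cin t) ?(ltW tl)//; last by move: t0 lp; lra.
    by rewrite subrr mul0r; split=> // th /sin ->//; [ring|move: t0 lp; lra].
  + rewrite (cup t) ?(ltW tl)// subrr mulr0.
    by split=> // th /(sup _ _ tl) ->; ring.
  + by rewrite (cup lam)// !subrr !mulr0; split=> // th _; ring.
- rewrite (cdn (- lam))// subrr mul0r; have [tl|tl|->] := ltgtP t (- lam).
  + rewrite (cdn t) ?(ltW tl)// subrr mulr0.
    by split=> // th /(sdn _ _ tl) ->; ring.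
  + rewrite (cin t) ?(ltW tl)//; last by move: t0 lp; lra.
    by rewrite subrr mul0r; split=> // th /sin ->//; [ring|move: t0 lp; lra].
  + by rewrite (cdn (- lam))// !subrr !mulr0; split=> // th _; ring.
- rewrite (cup s) ?(ltW s0)// (cup t) ?(ltW t0)// subrr !mulr0.
  by split=> // th /(sup _ _ t0) ->; ring.
- rewrite (cdn s) ?(ltW s0)// (cdn t) ?(ltW t0)// subrr !mulr0.
  by split=> // th /(sdn _ _ t0) ->; ring.
- rewrite (cin s) ?ltW// (cin t) ?ltW// !subrr !mul0r.
  by split=> // th /(sin _ _ t0 t1) ->; ring.
Qed.

Section Vector.
Context {n : nat}.
Implicit Types u v z : 'cV[R]_n.

Definition clipv u : 'cV[R]_n := \col_i clip (u i 0).
Definition soft u : 'cV[R]_n := u - clipv u.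

Lemma softE u i : soft u i 0 = u i 0 - clip (u i 0).
Proof. by rewrite !mxE. Qed.

Lemma soft_subgradient u z : dotp (u - soft u) z <= phi lam z.
Proof.
rewrite subKr /phi /l1norm mulr_sumr; apply: ler_sum => i _.
by rewrite mxE clip_le.
Qed.

Lemma soft_contact u : phi lam (soft u) = dotp (u - soft u) (soft u).
Proof.
rewrite subKr /phi /l1norm mulr_sumr; apply: eq_bigr => i _.
by rewrite softE mxE; have := clip_eq (u i 0) ler01; rewrite mul1r.
Qed.

Lemma prox_phi_soft : prox_phi lam = soft.
Proof.
apply/funext => u.
exact: (prox_sublinear soft_subgradient soft_contact).
Qed.

Definition soft_jac u (Theta : 'M[R]_n) :=
  (forall i j, i != j -> Theta i j = 0) /\ (forall i, slope (u i 0) (Theta i i)).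

Lemma soft_Jac_slope u : differentiable soft u -> soft_jac u (Jac soft u).
Proof.
move=> du.
have q j i : (fun k => k.+1%:R *
      (soft (u + k.+1%:R^-1 *: delta_mx j 0) i 0 - soft u i 0)) @ \oo
    --> Jac soft u i j.
  have -> : Jac soft u i j = 'd soft u (delta_mx j 0) i 0 by rewrite mxE.
  rewrite (_ : (fun k => _) = fun k =>
    (k.+1%:R *: (soft (u + k.+1%:R^-1 *: delta_mx j 0) - soft u)) i 0).
    exact: cvg_coord i 0 (cvg_quotient (delta_mx j 0) du).
  apply/funext => k.
  by rewrite [RHS]mxE [X in _ = _ * X]mxE [X in _ = _ * (_ + X)]mxE.
split=> [i j ij|i].
  apply: (cvg_eq_near (q j i)); apply: nearW => k.
  by rewrite !softE !mxE (negPf ij) mulr0 addr0 subrr mulr0.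
have hE k : (soft (u + k.+1%:R^-1 *: delta_mx i 0) i 0 - soft u i 0) =
   (u i 0 + k.+1%:R^-1 - clip (u i 0 + k.+1%:R^-1)) - (u i 0 - clip (u i 0)).
  by rewrite !softE !mxE !eqxx mulr1.
have k0 k : 0 < (k.+1%:R : R) by [].
have h0 k : 0 < (k.+1%:R^-1 : R) by rewrite invr_gt0.
have lip k := clip_lip (u i 0) (ltW (h0 k)).
have hsmall (e : R) : 0 < e -> \forall k \near \oo, (k.+1%:R^-1 : R) < e.
  by move=> e0; exact: cvg_near_lt cvg_harmonic e0.
have {}q := q i i; split.
- apply/andP; split.
    apply: (cvg_ge_near q); apply: nearW => k; rewrite hE mulr_ge0//.
    by case/andP: (lip k).
  apply: (cvg_le_near q); apply: nearW => k; rewrite hE.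
  by rewrite -ler_pdivlMl// mulr1; case/andP: (lip k).
- move=> out.
  have one k : k.+1%:R * ((u i 0 + k.+1%:R^-1) - u i 0) = 1 :> R.
    by field; rewrite gt_eqF.
  have near_one : (\forall k \near \oo,
      clip (u i 0 + k.+1%:R^-1) = clip (u i 0)) -> Jac soft u i i = 1.
    move=> cc; apply: (cvg_eq_near q); apply: filterS cc => k cc.
    by rewrite hE cc -[RHS](one k); ring.
  apply: near_one; have [l0|ln0] := eqVneq lam 0.
    have c0 x : clip x = 0.
      by case: (clipP x) => -[h ->]; move: h; rewrite l0; lra.
    by apply: nearW => k; rewrite !c0.
  have lp : 0 < lam by rewrite lt0r ln0.
  case: out => [|l0]; last by rewrite l0 eqxx in ln0.
  case: (leP 0 (u i 0)) => u0; [rewrite ger0_norm // | rewrite ltr0_norm //] => ul.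
    apply: nearW => k; move: (k.+1%:R^-1) (h0 k) => x x0.
    by case: (clipP (u i 0)) => -[p ->]; case: (clipP (u i 0 + x)) => -[p' ->] //;
      move: p p' x0 u0 ul lp; lra.
  have e0 : 0 < - lam - u i 0 by lra.
  apply: filterS (hsmall _ e0) => k; move: (k.+1%:R^-1) (h0 k) => x x0 xe.
  by case: (clipP (u i 0)) => -[p ->]; case: (clipP (u i 0 + x)) => -[p' ->] //;
    move: p p' x0 xe u0 ul lp; lra.
- move=> ul; apply: (cvg_eq_near q).
  have e0 : 0 < lam - u i 0 by have := ler_norm (u i 0); lra.
  apply: filterS (hsmall _ e0) => k; rewrite hE.
  move: (k.+1%:R^-1) (h0 k) => x x0 xe.
  move: ul; rewrite ltr_norml => /andP[ul1 ul2].
  suff [-> ->] : clip (u i 0) = u i 0 /\ clip (u i 0 + x) = u i 0 + x.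
    by rewrite !subrr mulr0.
  by case: (clipP (u i 0)) => -[p ->]; case: (clipP (u i 0 + x)) => -[p' ->];
    split=> //; move: p p' x0 xe ul1 ul2; lra.
Qed.

Lemma slope_convex t th1 th2 a : 0 <= a -> a <= 1 -> slope t th1 -> slope t th2 ->
  slope t (a * th1 + (1 - a) * th2).
Proof.
move=> a0 a1 [/andP[p1 q1] r1 s1] [/andP[p2 q2] r2 s2]; split.
- apply/andP; split; nra.
- by move=> h; rewrite (r1 h) (r2 h); ring.
- by move=> h; rewrite (s1 h) (s2 h); ring.
Qed.

Lemma slope_closed (t_ th_ : nat -> R) t th : t_ @ \oo --> t -> th_ @ \oo --> th ->
  (forall k, slope (t_ k) (th_ k)) -> slope t th.
Proof.
move=> tc thc sk; split.
- apply/andP; split.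
    by apply: (cvg_ge_near thc); apply: nearW => k; case: (sk k) => /andP[].
  by apply: (cvg_le_near thc); apply: nearW => k; case: (sk k) => /andP[].
- move=> [lt|l0]; apply: (cvg_eq_near thc).
    apply: filterS (cvg_near_gt (cvg_norm tc) lt) => k ltk.
    by case: (sk k) => _ + _; apply; left.
  by apply: nearW => k; case: (sk k) => _ + _; apply; right.
- move=> lt; apply: (cvg_eq_near thc).
  apply: filterS (cvg_near_lt (cvg_norm tc) lt) => k ltk.
  by case: (sk k) => _ _; apply.
Qed.

Lemma clarke_soft u : clarke_Jac soft u `<=` soft_jac u.
Proof.
apply: convex_hull_sub => [T1 T2 a a0 a1 [off1 s1] [off2 s2]|Theta [v [dv vu Jv]]].
  split=> [i j ij|i]; rewrite !mxE; first by rewrite off1// off2// !mulr0 addr0.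
  exact: slope_convex.
have sv k := soft_Jac_slope (dv k).
split=> [i j ij|i].
  apply: (cvg_eq_near (cvg_coord i j Jv)); apply: nearW => k.
  by case: (sv k) => + _; apply.
apply: (slope_closed (cvg_coord i 0 vu) (cvg_coord i i Jv)) => k.
by case: (sv k).
Qed.

(** The radius is common to all entries, each of which is treated by
    [soft_local]. *)
Lemma soft_near w : exists2 eps, 0 < eps & forall z, enorm (z - w) < eps ->
  [/\ forall Theta, soft_jac z Theta -> Theta *m (z - w) = soft z - soft w,
      forall i, soft z i 0 * (clipv z - clipv w) i 0 = 0 &
      forall i, soft w i 0 * (clipv z - clipv w) i 0 = 0].
Proof.
have [eps eps0 loc] : exists2 e, 0 < e & forall z, enorm (z - w) < e ->
  forall i : 'I_n, let t := z i 0 in let s := w i 0 in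
  [/\ forall th, slope t th -> th * (t - s) = (t - clip t) - (s - clip s),
      (t - clip t) * (clip t - clip s) = 0 &
      (s - clip s) * (clip t - clip s) = 0].
  apply: common_radius => i; have [e e0 le] := soft_local (w i 0).
  exists e => // z ze; apply: le; apply: le_lt_trans ze.
  by have := normr_le_enorm (z - w) i; rewrite !mxE.
exists eps => // z ze; have {}loc := loc z ze; split=> [Th [off sl]|i|i].
- apply/colP => i; have [+ _ _] := loc i; move=> /(_ _ (sl i)).
  rewrite mxE (bigD1 i) //= big1 => [|j ji]; last first.
    by rewrite off ?mul0r// eq_sym.
  by rewrite addr0 !mxE.
- by have [_ + _] := loc i; rewrite !mxE.
- by have [_ _] := loc i; rewrite !mxE.
Qed.

Definition soft_jac_diag u : 'M[R]_n :=
  diag_mx (\row_i ((lam < `|u i 0|) || (lam == 0))%:R).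

Lemma soft_Jac_diag u : (forall i, lam = 0 \/ `|u i 0| != lam) ->
  differentiable soft u /\ Jac soft u = soft_jac_diag u.
Proof.
move=> noncrit; have [e e0 near_u] := soft_near u.
have [r r0 side] : exists2 e, 0 < e & forall z, enorm (z - u) < e ->
  forall i : 'I_n, slope (z i 0) ((lam < `|u i 0|) || (lam == 0))%:R.
  apply: common_radius => i; have [l0|ul] := noncrit i.
    exists 1 => // z _; rewrite l0 eqxx orbT; split; rewrite ?ler01 ?lexx//.
    by rewrite l0 ltNge normr_ge0.
  have [l0|ln0] := eqVneq lam 0.
    exists 1 => // z _; rewrite orbT; split; rewrite ?ler01 ?lexx//.
    by rewrite l0 ltNge normr_ge0.
  rewrite orbF; exists `| `|u i 0| - lam|; first by rewrite normr_gt0 subr_eq0.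
  move=> z zu; have : `| `|z i 0| - `|u i 0| | < `| `|u i 0| - lam|.
    apply: le_lt_trans zu; apply: (le_trans (ler_dist_dist _ _)).
    by have := normr_le_enorm (z - u) i; rewrite !mxE.
  have [ul1|ul1] := ltP lam `|u i 0|.
    rewrite [X in _ < X]gtr0_norm ?subr_gt0// ltr_norml => /andP[h1 h2].
    split; rewrite ?ler01 ?lexx// => h3; exfalso; move: h1 h3; lra.
  have ul2 : `|u i 0| < lam by rewrite lt_neqAle ul.
  rewrite [X in _ < X]ltr0_norm ?subr_lt0// ltr_norml => /andP[h1 h2].
  split; rewrite ?ler01 ?lexx// => -[h3|h3]; exfalso; last first.
    by rewrite h3 eqxx in ln0.
  move: h2 h3; lra.
apply: (@Jac_quadratic _ _ _ _ _ _ 0 (Num.min e r)) => //.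
  by rewrite lt_min e0.
move=> z; rewrite lt_min => /andP[ze zr].
have [lin _ _] := near_u z ze.
rewrite -(lin (soft_jac_diag u)) ?subrr ?enorm0 ?mul0r//.
split=> [i j ij|i]; rewrite !mxE ?(negPf ij) ?mulr0n// eqxx mulr1n.
exact: side.
Qed.

Lemma clarke_soft_neq0 u : clarke_Jac soft u !=set0.
Proof.
(* Kinks are approached from inside the interval, where the slope is 0. *)
pose v (k : nat) : 'cV[R]_n := \col_i
  (if `|u i 0| == lam then (1 - k.+1%:R^-1) * u i 0 else u i 0).
have h0 k : 0 < (k.+1%:R^-1 : R) by rewrite invr_gt0.
have h1 k : (k.+1%:R^-1 : R) <= 1 by rewrite invf_le1 ?ler1n.
have norm_v k i : `|u i 0| = lam -> `|v k i 0| = (1 - k.+1%:R^-1) * lam.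
  by move=> ul; rewrite mxE ul eqxx normrM ul ger0_norm// subr_ge0.
have noncrit k i : lam = 0 \/ `|v k i 0| != lam.
  have [l0|ln0] := eqVneq lam 0; [by left|right].
  have lp : 0 < lam by rewrite lt0r ln0.
  have [ul|ul] := eqVneq `|u i 0| lam; last by rewrite mxE (negPf ul).
  by rewrite norm_v// lt_eqF// gtr_pMl// gtrBl.
have diag k : soft_jac_diag (v k) = soft_jac_diag u.
  congr diag_mx; apply/rowP => i; rewrite !mxE.
  case: eqVneq => // ul; rewrite normrM ul ltxx ger0_norm ?subr_ge0//.
  have [|ln0] := eqVneq lam 0; first by rewrite !orbT.
  by rewrite ltNge ger_pMl ?gerBl ?(ltW (h0 k))// lt0r ln0.
exists (soft_jac_diag u); apply: sub_convex_hull; exists v; split.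
- by move=> k; case: (soft_Jac_diag (noncrit k)).
- apply/cvg_enormP.
  have vu k : enorm (v k - u) <= k.+1%:R^-1 * enorm u.
    rewrite -[k.+1%:R^-1]gtr0_norm// -enormZ /enorm ler_sqrt ?dotp_ge0//.
    apply: ler_sum => i _; rewrite !mxE.
    case: eqVneq => _; last by rewrite subrr mulr0 -expr2 sqr_ge0.
    rewrite le_eqVlt; apply/orP; left; apply/eqP; ring.
  have lim0 : @harmonic R \* cst (enorm u) @ \oo --> (0 : R).
    by rewrite -(mul0r (enorm u)); exact: (cvgM cvg_harmonic (cvg_cst _)).
  apply: (squeeze_cvgr _ (cvg_cst 0) lim0).
  by apply: nearW => k; rewrite enorm_ge0 vu.
- have -> : (fun k => Jac soft (v k)) = fun=> soft_jac_diag u.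
    by apply/funext => k; case: (soft_Jac_diag (noncrit k)) => _ ->.
  exact: cvg_cst.
Qed.

End Vector.
End SoftThreshold.

(** * The sparse group Lasso regularizer *)

Lemma dotp_delta (R : realType) (n : nat) (M : 'M[R]_n) i j :
  dotp (M *m delta_mx j 0) (delta_mx i 0) = M i j.
Proof.
rewrite -colE /dotp (bigD1 i) //= big1 ?addr0 => [|k ki].
  by rewrite !mxE !eqxx mulr1.
by rewrite !mxE (negPf ki) mulr0.
Qed.

Lemma trmx_dotp_sym (R : realType) (n : nat) (M : 'M[R]_n) :
  (forall x y, dotp (M *m x) y = dotp (M *m y) x) -> M^T = M.
Proof. by move=> sym; apply/matrixP => i j; rewrite mxE -!dotp_delta sym. Qed.

Section GroupProx.
Context {R : realType} {n g : nat}.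
Variables (lambda1 lambda2 : R) (G : 'I_g -> {set 'I_n}) (w : 'I_g -> R).
Hypotheses (lambda1_ge0 : 0 <= lambda1).
Hypothesis lam_ge0 : forall l, 0 <= lambda2l lambda2 w l.
Hypothesis G_cover : forall i, exists l, i \in G l.
Hypothesis G_disjoint : forall i l l', i \in G l -> i \in G l' -> l = l'.
Implicit Types (u v x z : 'cV[R]_n) (l : 'I_g).

Local Notation lam := (lambda2l lambda2 w).
Local Notation rest l := (restr_mx G l : 'M[R]_(#|G l|, n)).
Local Notation S1 := (soft lambda1).

Lemma sum_group (a : 'I_g -> R) i l :
  i \in G l -> \sum_(l' | i \in G l') a l' = a l.
Proof.
move=> il; rewrite (bigD1 l) //= big1 ?addr0// => l' /andP[il' /eqP]; case.
exact: G_disjoint il' il.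
Qed.

Lemma restrE l x k : (rest l *m x) k 0 = x (enum_val k) 0.
Proof.
rewrite mxE (bigD1 (enum_val k)) //= big1 => [|j jk]; last first.
  by rewrite mxE eq_sym (negPf jk) mul0r.
by rewrite mxE eqxx mul1r addr0.
Qed.

(** The groups form a partition, so restriction to them is an isometry. *)
Lemma dotp_restr x z : \sum_l dotp (rest l *m x) (rest l *m z) = dotp x z.
Proof.
transitivity (\sum_l \sum_(i in G l) x i 0 * z i 0).
  apply: eq_bigr => l _; rewrite [RHS]big_enum_val.
  by apply: eq_bigr => k _; rewrite !restrE.
rewrite (exchange_big_dep xpredT) //=; apply: eq_bigr => i _.
by have [l il] := G_cover i; rewrite (sum_group (fun=> _) il).
Qed.

Lemma sum_restrT_restr : \sum_l (rest l)^T *m rest l = 1%:M.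
Proof.
apply/matrixP => i j; rewrite -!dotp_delta mul1mx -(dotp_restr (delta_mx j 0)).
rewrite mulmx_suml dotp_suml; apply: eq_bigr => l _.
by rewrite -mulmxA dotp_mulmx trmxK.
Qed.

Lemma enorm_restr l x : enorm (rest l *m x) <= enorm x.
Proof.
rewrite -(@ler_pXn2r _ 2)// ?nnegrE ?enorm_ge0// !enorm_sq -(dotp_restr x).
by rewrite (bigD1 l) //= lerDl sumr_ge0// => l' _; exact: dotp_ge0.
Qed.

Lemma enorm_restrT l y : enorm ((rest l)^T *m y) <= enorm y.
Proof.
rewrite -[leRHS]mul1r; apply: enorm_trmx_le => // x.
by rewrite mul1r enorm_restr.
Qed.

(** The proximal mapping of the regularizer: soft-thresholding followed, in each
    group, by subtraction of the projection onto a ball. *)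
Definition sgl_prox u : 'cV[R]_n :=
  \col_i ((\sum_(l | i \in G l) shrink (lam l) (rest l *m S1 u)) * S1 u i 0).

Lemma restr_sgl_prox l u :
  rest l *m sgl_prox u = shrink (lam l) (rest l *m S1 u) *: (rest l *m S1 u).
Proof.
apply/colP => k; rewrite restrE [LHS]mxE [RHS]mxE restrE.
by rewrite (sum_group _ (enum_valP k)).
Qed.

Lemma restr_sub_sgl_prox l u :
  rest l *m (S1 u - sgl_prox u) = ballp (lam l) (rest l *m S1 u).
Proof. by rewrite mulmxBr restr_sgl_prox -subr_ballp subKr. Qed.

Lemma sub_sgl_prox u : u - sgl_prox u = clipv lambda1 u + (S1 u - sgl_prox u).
Proof. by rewrite addrA /soft [clipv _ _ + _]addrC subrK. Qed.

Lemma sgl_prox_subgradient u z :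
  dotp (u - sgl_prox u) z <= sgl_reg lambda1 lambda2 G w z.
Proof.
rewrite sub_sgl_prox dotpDl; apply: lerD.
  by have := soft_subgradient lambda1_ge0 u z; rewrite /soft subKr.
rewrite -dotp_restr; apply: ler_sum => l _; rewrite restr_sub_sgl_prox.
rewrite (le_trans (dotp_le_enorm _ _))// ler_wpM2r ?enorm_ge0//.
exact: enorm_ballp.
Qed.

Lemma sgl_prox_contact u :
  sgl_reg lambda1 lambda2 G w (sgl_prox u) = dotp (u - sgl_prox u) (sgl_prox u).
Proof.
rewrite sub_sgl_prox dotpDl; congr (_ + _).
  rewrite /phi /l1norm mulr_sumr; apply: eq_bigr => i _.
  rewrite !mxE clip_eq// sumr_ge0// => l _; exact: shrink_ge0.
rewrite -dotp_restr; apply: eq_bigr => l _.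
by rewrite restr_sub_sgl_prox restr_sgl_prox dotp_ballp_shrink.
Qed.

Lemma sgl_reg_homogeneous t x : 0 <= t ->
  sgl_reg lambda1 lambda2 G w (t *: x) = t * sgl_reg lambda1 lambda2 G w x.
Proof.
move=> t0; rewrite /sgl_reg mulrDr; congr (_ + _).
  rewrite /phi /l1norm mulrCA; congr (_ * _); rewrite mulr_sumr.
  by apply: eq_bigr => i _; rewrite mxE normrM ger0_norm.
rewrite mulr_sumr; apply: eq_bigr => l _.
by rewrite -scalemxAr enormZ ger0_norm// mulrCA.
Qed.

Lemma group_sandwich (D : forall l, 'M[R]_#|G l|) :
  (group_mx G)^T *m (\mxdiag_(l < g) D l) *m group_mx G =
  \sum_l (rest l)^T *m D l *m rest l.
Proof.
rewrite /group_mx -mulmxA mul_mxdiag_mxcol tr_mxcol mul_mxrow_mxcol.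
by apply: eq_bigr => l _; rewrite mulmxA.
Qed.

Lemma MsetE u M : Mset lambda1 lambda2 G w u M ->
  exists (D : forall l, 'M[R]_#|G l|) Theta,
  [/\ forall l, ball_jac (lam l) (rest l *m S1 u) (D l), soft_jac lambda1 u Theta &
      forall x, M *m x = \sum_l (rest l)^T *m
        (rest l *m (Theta *m x) - D l *m (rest l *m (Theta *m x)))].
Proof.
move=> [D [ Theta [HD HT ->]]]; exists D, Theta.
move: HD HT; rewrite (prox_phi_soft lambda1_ge0) => HD HT; split.
- by move=> l; apply: clarke_ballp => //; exact: HD.
- exact: (clarke_soft lambda1_ge0).
move=> x; rewrite group_sandwich -sum_restrT_restr -sumrB -mulmxA mulmx_suml.
apply: eq_bigr => l _; rewrite mulmxBl mulmxBr -!mulmxA //.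
Qed.

Lemma Mset_neq0 u : Mset lambda1 lambda2 G w u !=set0.
Proof.
rewrite /Mset (prox_phi_soft lambda1_ge0).
have [ Theta HT] := clarke_soft_neq0 lambda1_ge0 u.
have HD l := clarke_ballp_neq0 (rest l *m S1 u) (lam_ge0 l).
pose D l := get (clarke_Jac (proj (eball (lam l))) (rest l *m S1 u)).
eexists; exists D, Theta; split=> // l.
by have [S HS] := HD l; apply: getPex; exists S.
Qed.

Lemma soft_jac_mulE u Theta x i : soft_jac lambda1 u Theta ->
  (Theta *m x) i 0 = Theta i i * x i 0.
Proof.
move=> [off _]; rewrite mxE (bigD1 i) //= big1 ?addr0// => j ji.
by rewrite off ?mul0r// eq_sym.
Qed.

(** On each group the matrix is a multiple of Theta plus a rank-one term along
    the thresholded vector v; since Theta v = v, the product is symmetric even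
    though its factors need not commute. *)
Lemma Mset_quadratic u M : Mset lambda1 lambda2 G w u M ->
  exists Q : 'I_g -> 'cV[R]_n -> 'cV[R]_n -> R,
  [/\ forall x z, dotp (M *m x) z = \sum_l Q l x z,
      forall l x z, Q l x z = Q l z x &
      forall l x, 0 <= Q l x x <= enorm (rest l *m x) ^+ 2].
Proof.
move=> /MsetE[D [ Theta [HD HT ME]]].
exists (fun l x z => dotp (rest l *m (Theta *m x) - D l *m (rest l *m (Theta *m x)))
   (rest l *m z)).
have form l : exists al be, [/\ 0 <= al, 0 <= be,
    al + be * enorm (rest l *m S1 u) ^+ 2 <= 1 & forall x z,
    dotp (rest l *m (Theta *m x) - D l *m (rest l *m (Theta *m x))) (rest l *m z)
    = al * (\sum_k Theta (enum_val k) (enum_val k) *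
            ((rest l *m x) k 0 * (rest l *m z) k 0))
      + be * (dotp (rest l *m S1 u) (rest l *m x) *
              dotp (rest l *m S1 u) (rest l *m z))].
  have [al [be [al0 be0 le1 E]]] := ball_jac_form (lam_ge0 l) (HD l).
  exists al, be; split=> // x z; rewrite E dotpDl !dotpZl mulrA.
  congr (_ * _ + _ * _ * _).
    by apply: eq_bigr => k _; rewrite !restrE (soft_jac_mulE _ _ HT) mulrA.
  apply: eq_bigr => k _; rewrite !restrE (soft_jac_mulE _ _ HT) mulrA.
  by rewrite softE slope_vanish//; case: HT.
split.
- move=> x z; rewrite ME dotp_suml; apply: eq_bigr => l _.
  by rewrite dotp_mulmx trmxK.
- move=> l x z; have [al [be [_ _ _ E]]] := form l; rewrite !E.
  congr (_ * _ + _ * _); last by rewrite mulrC.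
  by apply: eq_bigr => k _; rewrite [X in _ * X]mulrC.
- move=> l x; have [al [be [al0 be0 le1 ->]]] := form l.
  set q := \sum_k _; set r := rest l *m x; set v := rest l *m S1 u.
  have q0 : 0 <= q.
    apply: sumr_ge0 => k _; rewrite -expr2 mulr_ge0 ?sqr_ge0//.
    by case: HT => _ /(_ (enum_val k)) [/andP[]].
  have q1 : q <= enorm r ^+ 2.
    rewrite enorm_sq; apply: ler_sum => k _; rewrite -expr2 ler_piMl ?sqr_ge0//.
    by case: HT => _ /(_ (enum_val k)) [/andP[]].
  rewrite -expr2; apply/andP; split.
    exact: addr_ge0 (mulr_ge0 al0 q0) (mulr_ge0 be0 (sqr_ge0 _)).
  have vr : dotp v r ^+ 2 <= enorm v ^+ 2 * enorm r ^+ 2.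
    rewrite -exprMn -[leLHS]real_normK ?num_real//.
    by rewrite lerXn2r ?nnegrE ?mulr_ge0 ?enorm_ge0// normr_dotp.
  apply: (le_trans (lerD (ler_wpM2l al0 q1) (ler_wpM2l be0 vr))).
  by rewrite [be * _]mulrA -mulrDl ler_piMl ?sqr_ge0.
Qed.

Lemma Mset_sym u M x z : Mset lambda1 lambda2 G w u M ->
  dotp (M *m x) z = dotp (M *m z) x.
Proof. by move=> /Mset_quadratic[Q [E sym _]]; rewrite !E; apply: eq_bigr. Qed.

Lemma Mset_bounds u M x : Mset lambda1 lambda2 G w u M ->
  0 <= dotp (M *m x) x <= enorm x ^+ 2.
Proof.
move=> /Mset_quadratic[Q [-> _ bd]]; rewrite sumr_ge0 => [/=|l _]; last first.
  by case/andP: (bd l x).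
rewrite enorm_sq -dotp_restr; apply: ler_sum => l _; rewrite -enorm_sq.
by case/andP: (bd l x).
Qed.

(** Increments of the soft-thresholding step are reproduced by Theta, so the errors
    are those of the ball projections of the groups.  In the second estimate the
    clipped part drops out because it is locked where the proximal mapping is
    nonzero. *)
Lemma sgl_prox_local u : exists K eps, [/\ 0 <= K, 0 < eps &
  forall z, enorm (z - u) < eps ->
  (forall M, Mset lambda1 lambda2 G w z M ->
     enorm (sgl_prox z - sgl_prox u - M *m (z - u)) <= K * enorm (z - u) ^+ 2) /\
  `|dotp (sgl_prox z + sgl_prox u) (z - sgl_prox z - (u - sgl_prox u))| <=
     K * enorm (z - u) ^+ 3].
Proof.
have [e1 e10 near_u] := soft_near lambda1_ge0 u.
have /choice[K KP] l : exists K, 0 <= K /\ exists2 e, 0 < e &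
  forall z, enorm (z - u) < e ->
  let zl := rest l *m S1 z in let ul := rest l *m S1 u in
  (forall S, ball_jac (lam l) zl S -> enorm (shrink (lam l) zl *: zl -
      shrink (lam l) ul *: ul - ((zl - ul) - S *m (zl - ul)))
        <= K * enorm (z - u) ^+ 2) /\
  `|dotp (shrink (lam l) zl *: zl + shrink (lam l) ul *: ul)
         (ballp (lam l) zl - ballp (lam l) ul)| <= K * enorm (z - u) ^+ 3.
  have [K [e [K0 e0 loc]]] := ballp_local (rest l *m S1 u) (lam_ge0 l).
  exists K; split=> //; exists e => // z ze /=.
  have le_zu : enorm (rest l *m S1 z - rest l *m S1 u) <= enorm (z - u).
    rewrite -mulmxBr (le_trans (enorm_restr _ _))//.
    exact: (prox_nonexpansive (soft_subgradient lambda1_ge0) (@soft_contact _ _ _)).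
  have [loc1 loc2] := loc _ (le_lt_trans le_zu ze); split.
    move=> S HS; rewrite (le_trans (loc1 _ HS))// ler_wpM2l//.
    by rewrite lerXn2r ?nnegrE ?enorm_ge0.
  rewrite (le_trans loc2)// ler_wpM2l//.
  by rewrite lerXn2r ?nnegrE ?enorm_ge0.
have [e2 e20 groups] := common_radius (fun l => (KP l).2).
exists (\sum_l K l), (Num.min e1 e2); split.
- by apply: sumr_ge0 => l _; case: (KP l).
- by rewrite lt_min e10.
move=> z; rewrite lt_min => /andP[/near_u[lin lock_z lock_u] /groups loc]; split.
  move=> M /MsetE[D [ Theta [HD HT ME]]].
  have -> : sgl_prox z - sgl_prox u - M *m (z - u) =
     \sum_l (rest l)^T *m (shrink (lam l) (rest l *m S1 z) *: (rest l *m S1 z) -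
       shrink (lam l) (rest l *m S1 u) *: (rest l *m S1 u) -
       ((rest l *m S1 z - rest l *m S1 u) -
        D l *m (rest l *m S1 z - rest l *m S1 u))).
    rewrite -[X in X - _ = _]mul1mx -sum_restrT_restr mulmx_suml ME -sumrB.
    apply: eq_bigr => l _; rewrite (lin _ HT) -mulmxA -mulmxBr.
    congr (_ *m _); rewrite [_ *m (sgl_prox z - _)]mulmxBr !restr_sgl_prox.
    by rewrite [_ *m (S1 z - _)]mulmxBr.
  rewrite (le_trans (enorm_sum _ _ _))// mulr_suml; apply: ler_sum => l _.
  rewrite (le_trans (enorm_restrT _))//.
  by have [+ _] := loc l; apply; exact: HD.
have -> : dotp (sgl_prox z + sgl_prox u) (z - sgl_prox z - (u - sgl_prox u)) =
   \sum_l dotp (shrink (lam l) (rest l *m S1 z) *: (rest l *m S1 z) +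
                shrink (lam l) (rest l *m S1 u) *: (rest l *m S1 u))
     (ballp (lam l) (rest l *m S1 z) - ballp (lam l) (rest l *m S1 u)).
  rewrite !sub_sgl_prox opprD addrACA dotpDr.
  have -> : dotp (sgl_prox z + sgl_prox u) (clipv lambda1 z - clipv lambda1 u) = 0.
    rewrite dotpDl /dotp !big1 ?addr0// => i _; rewrite [sgl_prox _ i 0]mxE -mulrA.
      by rewrite lock_u mulr0.
    by rewrite lock_z mulr0.
  rewrite add0r -dotp_restr; apply: eq_bigr => l _.
  rewrite mulmxDr !restr_sgl_prox; congr (dotp _ _).
  by rewrite mulmxBr !restr_sub_sgl_prox.
rewrite (le_trans (ler_norm_sum _ _ _))// mulr_suml; apply: ler_sum => l _.
by case: (loc l).
Qed.

End GroupProx.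

(** * Convergence of the method *)

Section PartitionCover.
Context {n g : nat}.
Variable G : 'I_g -> {set 'I_n}.
Hypothesis G_inj : injective G.
Hypothesis G_partition :
  finset.partition [set G l | l : 'I_g]%SET [set: 'I_n]%SET.

Lemma partition_cover i : exists l, i \in G l.
Proof.
have /and3P[/eqP cov _ _] := G_partition.
have : i \in finset.cover [set G l | l : 'I_g]%SET by rewrite cov finset.in_setT.
by case/finset.bigcupP => B /imsetP[l _ ->] il; exists l.
Qed.

Lemma partition_disjoint i l l' : i \in G l -> i \in G l' -> l = l'.
Proof.
have /and3P[_ /finset.trivIsetP tr _] := G_partition.
move=> il il'; apply/eqP/negP => /negP ll'.
have := tr (G l) (G l') (imset_f _ _) (imset_f _ _).
rewrite (inj_eq G_inj) => /(_ isT isT ll').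
by move=> /disjointFr/(_ il); rewrite il'.
Qed.

End PartitionCover.

Section Newton.
Context {R : realType} {n m g : nat}.
Variables (A : 'M[R]_(m, n)) (b : 'cV[R]_m) (lambda1 lambda2 : R).
Variables (G : 'I_g -> {set 'I_n}) (w : 'I_g -> R).
Variables (sigma : R) (xtilde : 'cV[R]_n).
Hypotheses (lambda1_ge0 : 0 <= lambda1).
Hypothesis lam_ge0 : forall l, 0 <= lambda2l lambda2 w l.
Hypothesis G_cover : forall i, exists l, i \in G l.
Hypothesis G_disjoint : forall i l l', i \in G l -> i \in G l' -> l = l'.
Hypothesis sigma_gt0 : 0 < sigma.
Variable c : R.
Hypothesis c_ge0 : 0 <= c.
Hypothesis A_le : forall x, enorm (A *m x) <= c * enorm x.

Local Notation x0 := (sigma^-1 *: xtilde).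
Local Notation F := (sgl_prox lambda1 lambda2 G w).
Local Notation grad_psi := (dual_grad A b sigma x0 F).
Local Notation Vs := (newton_mx A lambda1 lambda2 G w sigma xtilde).

Let F_le := sgl_prox_subgradient lambda1_ge0 lam_ge0 G_cover G_disjoint.
Let F_eq := sgl_prox_contact lambda1 lam_ge0 G_cover G_disjoint.

Lemma psi_dual_obj :
  psi A b lambda1 lambda2 G w sigma xtilde = dual_obj A b sigma x0 F.
Proof.
apply/funext => y; rewrite /psi /dual_obj /dual_pt (prox_sublinear F_le F_eq).
rewrite /sgl_reg_conj (fine_conjugate_homogeneous _ (sgl_reg_homogeneous _ _ _ _)).
by rewrite addr0.
Qed.

Lemma newton_mx_neq0 y : Vs y !=set0.
Proof.
have [M HM] := Mset_neq0 G lambda1_ge0 lam_ge0 (x0 - A^T *m y).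
by eexists; exists M.
Qed.

Lemma newton_mx_dotp M x z :
  dotp ((1%:M + sigma *: (A *m M *m A^T)) *m x) z =
  dotp x z + sigma * dotp (M *m (A^T *m x)) (A^T *m z).
Proof.
rewrite mulmxDl mul1mx dotpDl -scalemxAl dotpZl -!mulmxA dotp_mulmx.
by [].
Qed.

Lemma newton_mx_sym y V : Vs y V -> V^T = V.
Proof.
move=> [M HM ->]; apply: trmx_dotp_sym => x z.
rewrite !newton_mx_dotp (dotpC z x); congr (_ + _ * _).
exact: (Mset_sym lambda1_ge0 lam_ge0 G_cover G_disjoint _ _ HM).
Qed.

Lemma newton_mx_ge y V : Vs y V -> forall x, dotp x x <= dotp (V *m x) x.
Proof.
move=> [M HM ->] x; rewrite newton_mx_dotp lerDl mulr_ge0 ?(ltW sigma_gt0)//.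
have /andP[//] :=
  Mset_bounds lambda1_ge0 lam_ge0 G_cover G_disjoint (A^T *m x) HM.
Qed.

Lemma newton_mx_le y V : Vs y V ->
  forall x, dotp (V *m x) x <= (1 + sigma * c ^+ 2) * dotp x x.
Proof.
move=> [M HM ->] x; rewrite newton_mx_dotp mulrDl mul1r lerD2l -mulrA ler_pM2l//.
have /andP[_ le1] :=
  Mset_bounds lambda1_ge0 lam_ge0 G_cover G_disjoint (A^T *m x) HM.
rewrite (le_trans le1)// -enorm_sq -exprMn.
by rewrite lerXn2r ?nnegrE ?mulr_ge0 ?enorm_ge0// (enorm_trmx_le c_ge0 A_le).
Qed.

(** Both errors are inherited from the proximal mapping through
    u = x0 - A^T y, whose increment is - A^T (y - ybar). *)
Lemma newton_local ybar : grad_psi ybar = 0 ->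
  exists K eps, [/\ 0 <= K, 0 < eps,
    forall y V, enorm (y - ybar) < eps -> Vs y V ->
      enorm (grad_psi y - V *m (y - ybar)) <= K * enorm (y - ybar) ^+ 2 &
    forall y, enorm (y - ybar) < eps ->
      `|dual_obj A b sigma x0 F y - dual_obj A b sigma x0 F ybar
        - 2^-1 * dotp (grad_psi y) (y - ybar)| <= K * enorm (y - ybar) ^+ 3].
Proof.
move=> g0; set u := dual_pt A x0; have At_le := enorm_trmx_le c_ge0 A_le.
have [K [e [K0 e0 loc]]] :=
  sgl_prox_local lambda1_ge0 lam_ge0 G_cover G_disjoint (u ybar).
have c1 : 0 < c + 1 by rewrite ltr_wpDl.
have u_le y : enorm (u y - u ybar) <= c * enorm (y - ybar).
  by rewrite dual_ptB enormN.
have u_leX k y : enorm (u y - u ybar) ^+ k <= c ^+ k * enorm (y - ybar) ^+ k.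
  by rewrite -exprMn lerXn2r ?nnegrE ?mulr_ge0 ?enorm_ge0.
have u_near y : enorm (y - ybar) < e / (c + 1) -> enorm (u y - u ybar) < e.
  rewrite ltr_pdivlMr// => ye; apply: le_lt_trans ye; apply: (le_trans (u_le y)).
  by rewrite mulrC ler_wpM2l ?enorm_ge0// lerDl.
pose K2 := sigma * (c * (K * c ^+ 2)); pose K3 := sigma / 2 * (K * c ^+ 3).
have K20 : 0 <= K2 by rewrite !mulr_ge0 ?exprn_ge0// ltW.
have K30 : 0 <= K3 by rewrite !mulr_ge0 ?exprn_ge0// ltW.
exists (K2 + K3), (e / (c + 1)); split.
- exact: addr_ge0.
- by rewrite divr_gt0.
- move=> y V ye [M HM ->].
  have -> : grad_psi y - (1%:M + sigma *: (A *m M *m A^T)) *m (y - ybar) =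
      - (sigma *: (A *m (F (u y) - F (u ybar) - M *m (u y - u ybar)))).
    rewrite -[grad_psi y]subr0 -g0 /dual_grad -/u mulmxDl mul1mx -scalemxAl.
    rewrite -!mulmxA -[A^T *m _]opprK -(dual_ptB A x0) -/u !mulmxBr !mulmxN.
    rewrite !mulmxBr.
    move: (A *m F _) (A *m F _) (A *m (M *m _)) (A *m (M *m _)) => v1 v2 v3 v4.
    by apply/colP => i; rewrite !mxE; ring.
  rewrite enormN enormZ gtr0_norm//.
  apply: (le_trans (y := K2 * enorm (y - ybar) ^+ 2)); last first.
    by rewrite ler_wpM2r ?sqr_ge0// lerDl.
  have -> : K2 * enorm (y - ybar) ^+ 2 =
      sigma * (c * (K * (c ^+ 2 * enorm (y - ybar) ^+ 2))) by rewrite /K2; ring.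
  rewrite ler_pM2l// (le_trans (A_le _))// ler_wpM2l//.
  have [+ _] := loc _ (u_near y ye) => /(_ _ HM) /le_trans; apply.
  by rewrite ler_wpM2l// u_leX.
- move=> y ye.
  have := dual_trapezoid A b sigma x0 F y ybar; rewrite g0 addr0 -/u => ->.
  rewrite normrN normrM ger0_norm; last by rewrite divr_ge0// ltW.
  apply: (le_trans (y := K3 * enorm (y - ybar) ^+ 3)); last first.
    by rewrite ler_wpM2r ?exprn_ge0 ?enorm_ge0// lerDr.
  have -> : K3 * enorm (y - ybar) ^+ 3 =
      sigma / 2 * (K * (c ^+ 3 * enorm (y - ybar) ^+ 3)) by rewrite /K3; ring.
  rewrite ler_pM2l ?divr_gt0//.
  have [_ /le_trans] := loc _ (u_near y ye); apply.
  by rewrite ler_wpM2l// u_leX.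
Qed.

End Newton.

Theorem theorem4p2 (R : realType) (n m g : nat)
    (A : 'M[R]_(m, n)) (b : 'cV[R]_m) (lambda1 lambda2 : R)
    (G : 'I_g -> {set 'I_n}) (w : 'I_g -> R)
    (sigma : R) (xtilde : 'cV[R]_n)
    (mu eta tau delta : R) (y0 : 'cV[R]_m)
    (lambda1_ge0 : 0 <= lambda1) (lambda2_ge0 : 0 <= lambda2)
    (lambda_gt0 : 0 < lambda1 + lambda2)
    (G_inj : injective G)
    (G_partition : finset.partition [set G l | l : 'I_g]%SET [set: 'I_n]%SET)
    (w_gt0 : forall l, 0 < w l)
    (sigma_gt0 : 0 < sigma)
    (mu_range : 0 < mu < 1 / 2) (eta_range : 0 < eta < 1)
    (tau_range : 0 < tau <= 1) (delta_range : 0 < delta < 1) :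
  let f := psi A b lambda1 lambda2 G w sigma xtilde in
  let Vs := newton_mx A lambda1 lambda2 G w sigma xtilde in
  ssn_well_defined f Vs mu eta tau delta /\
  (exists y, ssn_sequence f Vs mu eta tau delta y0 y) /\
  exists ybar : 'cV[R]_m,
    [/\ is_minimizer f ybar,
        forall z, is_minimizer f z -> z = ybar &
        forall y : nat -> 'cV[R]_m,
          ssn_sequence f Vs mu eta tau delta y0 y ->
          [/\ y @ \oo --> ybar,
              (fun j => enorm (y j.+1 - ybar) : R^o) =o_\oo
                (fun j => enorm (y j - ybar) : R^o) &
              (fun j => enorm (y j.+1 - ybar) : R^o) =O_\oo
                (fun j => enorm (y j - ybar) `^ (1 + tau) : R^o)]].
Proof.
move=> f Vs; case/andP: mu_range => mu0 mu12; case/andP: tau_range => tau0 tau1.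
case/andP: delta_range => delta0 delta1.
have lam_ge0 l : 0 <= lambda2l lambda2 w l by rewrite mulr_ge0// ltW.
have Gc := partition_cover G_partition.
have Gd := partition_disjoint G_inj G_partition.
have [c c0 A_le] := enorm_mulmx_bounded A.
have At_le := enorm_trmx_le c0 A_le.
have F_le := sgl_prox_subgradient lambda1_ge0 lam_ge0 Gc Gd.
have F_eq := sgl_prox_contact lambda1 lam_ge0 Gc Gd.
pose L := 1 + sigma * c ^+ 2.
have L1 : 1 <= L by rewrite lerDl mulr_ge0 ?sqr_ge0// ltW.
pose F := sgl_prox lambda1 lambda2 G w.
pose gr := dual_grad A b sigma (sigma^-1 *: xtilde) F.
have fE : f = dual_obj A b sigma (sigma^-1 *: xtilde) F.
  exact: psi_dual_obj.
have low y z : f y + dotp (gr y) (z - y) + 2^-1 * enorm (z - y) ^+ 2 <= f z.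
  by rewrite fE; exact: dual_obj_lower.
have upp y z : f z <= f y + dotp (gr y) (z - y) + L / 2 * enorm (z - y) ^+ 2.
  by rewrite fE; exact: dual_obj_upper.
have lip y z : enorm (gr y - gr z) <= L * enorm (y - z).
  exact: dual_grad_lip.
have Vs0 : forall y, Vs y !=set0 by exact: newton_mx_neq0.
have Vsym : forall y V, Vs y V -> V^T = V.
  by move=> y V; apply: newton_mx_sym.
have Vge : forall y V, Vs y V -> forall x, dotp x x <= dotp (V *m x) x.
  by move=> y V; apply: newton_mx_ge.
have Vle : forall y V, Vs y V -> forall x, dotp (V *m x) x <= L * dotp x x.
  by move=> y V; apply: newton_mx_le.
split; first exact: (ssn_well_definedP (g := gr) (L := L)).
split; first exact: (ssn_sequence_exists (g := gr) (L := L)).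
have [ybar ymin] := minimizer_exists low upp.
have g0 := minimizer_g0 L1 upp ymin.
exists ybar; split=> //.
  by move=> z; exact: (g0_unique low g0).
move=> y ys.
have [K [e [K0 e0 gloc floc]]] :=
  newton_local lambda1_ge0 lam_ge0 Gc Gd sigma_gt0 c0 A_le g0.
rewrite -fE in floc.
exact: (ssn_rate mu0 mu12 eta_range tau0 tau1 delta0 delta1 L1 low upp lip
  Vsym Vge Vle g0 K0 e0 gloc floc ys).
Qed.
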